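(* Let $n\ge2$, let $\Lambda\in P^0_{\mathrm{aff}}$ be a level-zero dominant weight of $\mathfrak g(A_{2n}^{(2)})$, let $\lambda\in P$ be the corresponding dominant weight of type $C_n$, and $S=S_\lambda$. For $\pi=(x_1,\dots,x_s;\sigma_0,\dots,\sigma_s)\in\mathrm{SiLS}(\Lambda)$, write $x_i=w_iz_{\mu_i}t(\mu_i)$ with $w_i\in W^S$, $\mu_i\in Q^\vee_{S\text{-adj}}$, and put $\mathrm{cl}(\pi)=(w_1,\dots,w_s;\sigma_0,\dots,\sigma_s)$. Then $\mathrm{cl}(\pi)\in\mathrm{QLS}(\lambda)$ for every $\pi\in\mathrm{SiLS}(\Lambda)$; moreover, the resulting map $\mathrm{cl}:\mathrm{SiLS}(\Lambda)\to\mathrm{QLS}(\lambda)$ is surjective.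
   Context: $\Delta$ is the root system of type $C_n$, with simple roots $\alpha_i$ ($i\in I=\{1,\dots,n\}$, $\alpha_n$ long), positive roots $\Delta^+$, long roots $\Delta^\ell$, coroot lattice $Q^\vee$, weight lattice $P$, Weyl group $W$ with length $\ell$, $\rho=\frac12\sum_{\alpha\in\Delta^+}\alpha$, pairing $\langle\cdot,\cdot\rangle$ between weights and coweights. $c_\alpha=1$ for $\alpha$ short, $c_\alpha=2$ for $\alpha$ long. For $S\subset I$: $W_S=\langle s_i:i\in S\rangle$, $\Delta_S=\Delta\cap\sum_{i\in S}\mathbb Z\alpha_i$, $\Delta_S^+=\Delta_S\cap\Delta^+$, $\rho_S=\frac12\sum_{\alpha\in\Delta_S^+}\alpha$, $W^S$ = minimal-length representatives of $W/W_S$, $\lfloor w\rfloor$ = minimal-length element of $wW_S$. $S_\lambda=\{i\in I:\langle\lambda,\alpha_i^\vee\rangle=0\}$. Affine data: the real roots of $\mathfrak g(A_{2n}^{(2)})$ (null root $\delta$) are $\Delta_{\mathrm{aff}}=\{\alpha+c_\alpha a\delta:\alpha\in\Delta,a\in\mathbb Z\}\sqcup\{\frac12(\alpha+(2a-1)\delta):\alpha\in\Delta^\ell,a\in\mathbb Z\}$; $\Delta_{\mathrm{aff}}^+$ consists of those with positive $\delta$-coefficient together with $\Delta^+$. Level-zero weights are $P^0_{\mathrm{aff}}=P\oplus\frac12\mathbb Z\delta$, where $\varpi_i\in P$ is identified with $\Lambda_i-\langle\Lambda_i,c\rangle\Lambda_0$; $\lambda$ is the projection of $\Lambda$ to $P$,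 and $\Lambda$ is level-zero dominant if $\lambda$ is dominant. $t(x)$, $x\in Q^\vee$, acts by $t(x)(y+a\delta)=y+(a-\langle y,x\rangle)\delta$; $W_{\mathrm{aff}}=t(Q^\vee)\rtimes W$. The reflection in $\beta\in\Delta_{\mathrm{aff}}$ is $s_\beta=s_\alpha t(ac_\alpha\alpha^\vee)$ for $\beta=\alpha+ac_\alpha\delta$, and $s_\beta=s_\alpha t((2a-1)\alpha^\vee)$ for $\beta=\frac12(\alpha+(2a-1)\delta)$. For a level-zero weight $M$ with projection $\mu\in P$: $\langle M,(\alpha+c_\alpha a\delta)^\vee\rangle_{\mathrm{aff}}=\langle\mu,\alpha^\vee\rangle$ and $\langle M,(\frac12(\alpha+(2a-1)\delta))^\vee\rangle_{\mathrm{aff}}=2\langle\mu,\alpha^\vee\rangle$. Let $\Delta_{S,\mathrm{aff}}^+$ be the set of elements of $\Delta^+_{\mathrm{aff}}$ of the form $\alpha+c_\alpha a\delta$ ($\alpha\in\Delta_S$) or $\frac12(\alpha+(2a-1)\delta)$ ($\alpha\in\Delta_S\cap\Delta^\ell$), and $W^S_{\mathrm{aff}}=\{x\in W_{\mathrm{aff}}:x\beta\in\Delta_{\mathrm{aff}}^+\ \forall\beta\in\Delta_{S,\mathrm{aff}}^+\}$. $Q^\vee_{S\text{-adj}}=\{\mu\in Q^\vee:\langle\gamma,\mu\rangle\in\{0,-1\}\ \forall\gamma\in\Delta_S^+\}$. For $\mu\in Q^\vee_{S\text{-adj}}$, $z_\mu$ is the unique element of $W_S$ with $z_\mu t(\mu)\in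 W^S_{\mathrm{aff}}$; every element of $W^S_{\mathrm{aff}}$ is uniquely $wz_\mu t(\mu)$ with $w\in W^S$, $\mu\in Q^\vee_{S\text{-adj}}$. For $x=wt(\mu)\in W_{\mathrm{aff}}$ ($w\in W$, $\mu\in Q^\vee$) let $\ell^{\infty/2}(x)=\ell(w)+2\langle\rho,\mu\rangle$. The semi-infinite Bruhat graph $\mathrm{SiB}^S$ has vertex set $W^S_{\mathrm{aff}}$ and an edge $x\xrightarrow{\beta}s_\beta x$ ($\beta\in\Delta^+_{\mathrm{aff}}$) whenever $s_\beta x\in W_{\mathrm{aff}}^S$ and $\ell^{\infty/2}(s_\beta x)=\ell^{\infty/2}(x)+1$. For $b\in\mathbb Q\cap[0,1]$, $\mathrm{SiB}^S_{b\Lambda}$ is the subgraph with all vertices and the edges with $b\langle x\Lambda,\beta^\vee\rangle_{\mathrm{aff}}\in\mathbb Z$. $\mathrm{SiLS}(\Lambda)$ is the set of $(x_1,\dots,x_s;\tau_0,\dots,\tau_s)$ with $x_i\in W_{\mathrm{aff}}^S$ and rationals $0=\tau_0<\cdots<\tau_s=1$ such that for $1\le i\le s-1$ there is a directed path from $x_{i+1}$ to $x_i$ in $\mathrm{SiB}^S_{\tau_i\Lambda}$. $\mathrm{QBG}^S$ (type $C_n$): vertex set $W^S$; for $u\in W^S$, $\beta\in\Delta^+\setminus\Delta_S^+$ there is an edge $u\xrightarrow{\beta}v=\lfloor us_\beta\rfloor$ if $\ell(v)=\ell(u)+1$ (Bruhat) or $\ell(v)=\ell(u)-2\langle\rho-\rho_S,\beta^\vee\rangle+1$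 (quantum). $(\mathrm{QBG}^{A_{2n}^{(2)}}_{b\lambda})^S$ keeps only the edges with $b\langle\lambda,\beta^\vee\rangle\in\mathbb Z$ if $\beta$ is short or the edge is Bruhat, and $b\langle\lambda,\beta^\vee\rangle\in\frac12\mathbb Z$ if the edge is quantum with $\beta$ long. $\mathrm{QLS}(\lambda)$ is the set of $(w_1,\dots,w_s;\tau_0,\dots,\tau_s)$ with $w_i\in W^S$ and rationals $0=\tau_0<\cdots<\tau_s=1$ such that for $1\le i\le s-1$ there is a directed path from $w_{i+1}$ to $w_i$ in $(\mathrm{QBG}^{A_{2n}^{(2)}}_{\tau_i\lambda})^S$ (consecutive elements are not required to be distinct, neither here nor in $\mathrm{SiLS}(\Lambda)$). *)

(* Defs.v *)
From Stdlib Require Export Relations.Relation_Operators.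
From mathcomp Require Export all_boot all_order all_algebra.
From mathcomp Require Export boolp classical_sets fsbigop.

Set Implicit Arguments.
Unset Strict Implicit.
Unset Printing Implicit Defensive.

Import Order.TTheory GRing.Theory Num.Theory.

Local Open Scope classical_set_scope.
Local Open Scope ring_scope.

(** Realization of C_n with alpha_i = eps_i - eps_(i+1) for i < n and
    alpha_n = 2 eps_n.  Weights and coweights both live in Q^n (column vectors, so that matrices
    act on the left and matrix product is composition) and are paired by the
    standard scalar product.  The index set I = {1, ..., n} is ['I_n], shifted
    by one: alpha_n is attached to the ordinal of value n.-1. *)

Definition pairing n (y x : 'cV[rat]_n) : rat := \sum_(i < n) y i 0 * x i 0.

Definition eps n (i : 'I_n) : 'cV[rat]_n := delta_mx i 0.

Definition simple_root n (i : 'I_n) : 'cV[rat]_n :=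
  \col_(j < n) (if i.+1 == n then 2 * (j == i)%:R
                else (j == i)%:R - (j == i.+1 :> nat)%:R).

Definition long_roots n : set 'cV[rat]_n :=
  [set a | exists (i : 'I_n) (s : bool), a = (-1) ^+ s *: (2 *: eps i)].

Definition short_roots n : set 'cV[rat]_n :=
  [set a | exists (i j : 'I_n) (s t : bool),
     i != j /\ a = (-1) ^+ s *: eps i + (-1) ^+ t *: eps j].

Definition roots n : set 'cV[rat]_n := @long_roots n `|` @short_roots n.

Definition pos_roots n : set 'cV[rat]_n :=
  @roots n `&`
  [set a | exists m : 'I_n -> nat, a = \sum_i (m i)%:R *: simple_root i].

Definition coroot n (a : 'cV[rat]_n) : 'cV[rat]_n := (2 / pairing a a) *: a.

Definition croot n (a : 'cV[rat]_n) : int := if a \in @long_roots n then 2 else 1.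

Definition weight_lattice n : set 'cV[rat]_n :=
  [set y | forall i : 'I_n, pairing y (coroot (simple_root i)) \is a Num.int].

Definition coroot_lattice n : set 'cV[rat]_n :=
  [set x | exists m : 'I_n -> int,
     x = \sum_i (m i)%:~R *: coroot (simple_root i)].

Definition dominant n (y : 'cV[rat]_n) : Prop :=
  forall i : 'I_n, 0 <= pairing y (coroot (simple_root i)).

Definition stab_index n (y : 'cV[rat]_n) : set 'I_n :=
  [set i | pairing y (coroot (simple_root i)) = 0].

Definition roots_S n (S : set 'I_n) : set 'cV[rat]_n :=
  @roots n `&`
  [set a | exists m : 'I_n -> int, a = \sum_(i in S) (m i)%:~R *: simple_root i].

Definition pos_roots_S n (S : set 'I_n) : set 'cV[rat]_n :=
  roots_S S `&` @pos_roots n.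

Definition rho n : 'cV[rat]_n := 2^-1 *: \sum_(a \in @pos_roots n) a.

Definition rho_S n (S : set 'I_n) : 'cV[rat]_n :=
  2^-1 *: \sum_(a \in pos_roots_S S) a.

(* This matrix gives both actions of s_alpha, y |-> y - <y, alpha^v> alpha on
   weights and x |-> x - <alpha, x> alpha^v on coweights. *)
Definition refl n (a : 'cV[rat]_n) : 'M[rat]_n := 1%:M - a *m (coroot a)^T.

Definition word n (s : seq 'I_n) : 'M[rat]_n :=
  \big[mulmx/1%:M]_(i <- s) refl (simple_root i).

Definition weyl n : set 'M[rat]_n := range (@word n).

Definition weyl_S n (S : set 'I_n) : set 'M[rat]_n :=
  @word n @` [set s | forall i, i \in s -> S i].

(* The default value is irrelevant: it is only reached outside W. *)
Definition length n (w : 'M[rat]_n) : nat :=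
  xget 0%N [set k | (exists2 s, word s = w & size s = k) /\
                    forall s, word s = w -> (k <= size s)%N].

Definition coset_S n (S : set 'I_n) (w : 'M[rat]_n) : set 'M[rat]_n :=
  mulmx w @` weyl_S S.

Definition is_min_in_coset n (S : set 'I_n) (w v : 'M[rat]_n) : Prop :=
  coset_S S w v /\ forall v', coset_S S w v' -> (length v <= length v')%N.

Definition floor_S n (S : set 'I_n) (w : 'M[rat]_n) : 'M[rat]_n :=
  xget w (is_min_in_coset S w).

Definition min_reps n (S : set 'I_n) : set 'M[rat]_n :=
  [set w | weyl w /\ is_min_in_coset S w w].

(** Level-zero weights and real roots of A_{2n}^{(2)} live in Q^n + Q delta; the
    pair (y, a) stands for y + a delta. *)

Definition level0_weights n : set ('cV[rat]_n * rat) :=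
  [set L | weight_lattice L.1 /\ 2 * L.2 \is a Num.int].

(* Labels of the real roots: [AffFull alpha a] is alpha + c_alpha a delta and
   [AffHalf alpha a] is (alpha + (2a-1) delta) / 2.  Labels satisfying
   [is_aff_root] correspond bijectively to the elements of Delta_aff. *)
Inductive aff_label n : Type :=
  | AffFull of 'cV[rat]_n & int
  | AffHalf of 'cV[rat]_n & int.

Definition label_root n (b : aff_label n) : 'cV[rat]_n :=
  match b with AffFull al _ => al | AffHalf al _ => al end.

Definition is_aff_root n (b : aff_label n) : Prop :=
  match b with
  | AffFull al _ => roots al
  | AffHalf al _ => long_roots al
  end.

Definition aff_vec n (b : aff_label n) : 'cV[rat]_n * rat :=
  match b with
  | AffFull al a => (al, (croot al * a)%:~R)
  | AffHalf al a => (2^-1 *: al, 2^-1 * (2 * a - 1)%:~R)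
  end.

Definition aff_roots n : set ('cV[rat]_n * rat) :=
  @aff_vec n @` @is_aff_root n.

Definition aff_pos_roots n : set ('cV[rat]_n * rat) :=
  [set v | (aff_roots v /\ 0 < v.2) \/ (pos_roots v.1 /\ v.2 = 0)].

Definition aff_pos_roots_S n (S : set 'I_n) : set ('cV[rat]_n * rat) :=
  @aff_pos_roots n `&`
  (@aff_vec n @` [set b | is_aff_root b /\ roots_S S (label_root b)]).

Definition aff_pairing n (M : 'cV[rat]_n * rat) (b : aff_label n) : rat :=
  match b with
  | AffFull al _ => pairing M.1 (coroot al)
  | AffHalf al _ => 2 * pairing M.1 (coroot al)
  end.

(** The pair (w, x) stands for w t(x). *)

Definition aff_weyl n : set ('M[rat]_n * 'cV[rat]_n) :=
  [set x | weyl x.1 /\ coroot_lattice x.2].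

(* w t(x) v t(y) = w v t(v^-1 x + y) *)
Definition aff_mul n (x y : 'M[rat]_n * 'cV[rat]_n) : 'M[rat]_n * 'cV[rat]_n :=
  (x.1 *m y.1, invmx y.1 *m x.2 + y.2).

Definition aff_act n (x : 'M[rat]_n * 'cV[rat]_n) (v : 'cV[rat]_n * rat) :
    'cV[rat]_n * rat :=
  (x.1 *m v.1, v.2 - pairing v.1 x.2).

Definition aff_refl n (b : aff_label n) : 'M[rat]_n * 'cV[rat]_n :=
  match b with
  | AffFull al a => (refl al, (a * croot al)%:~R *: coroot al)
  | AffHalf al a => (refl al, (2 * a - 1)%:~R *: coroot al)
  end.

Definition aff_weyl_S n (S : set 'I_n) : set ('M[rat]_n * 'cV[rat]_n) :=
  [set x | aff_weyl x /\
     forall b, aff_pos_roots_S S b -> aff_pos_roots (aff_act x b)].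

Definition S_adjusted n (S : set 'I_n) : set 'cV[rat]_n :=
  [set mu | coroot_lattice mu /\
     forall g, pos_roots_S S g -> pairing g mu = 0 \/ pairing g mu = -1].

(* z_mu, which is the unique element of this set when mu is S-adjusted. *)
Definition zelt n (S : set 'I_n) (mu : 'cV[rat]_n) : 'M[rat]_n :=
  xget 1%:M [set z | weyl_S S z /\ aff_weyl_S S (z, mu)].

Definition si_length n (x : 'M[rat]_n * 'cV[rat]_n) : rat :=
  (length x.1)%:R + 2 * pairing (rho n) x.2.

Definition SiB_edge n (S : set 'I_n) (L : 'cV[rat]_n * rat) (b : rat)
    (x y : 'M[rat]_n * 'cV[rat]_n) : Prop :=
  [/\ aff_weyl_S S x, aff_weyl_S S y, si_length y = si_length x + 1 &
    exists be : aff_label n,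
      [/\ is_aff_root be, aff_pos_roots (aff_vec be),
          y = aff_mul (aff_refl be) x
        & b * aff_pairing (aff_act x L) be \is a Num.int]].

Definition is_bruhat n (u v : 'M[rat]_n) : Prop :=
  length v = (length u).+1.

Definition is_quantum n (S : set 'I_n) (be : 'cV[rat]_n) (u v : 'M[rat]_n) : Prop :=
  (length v)%:R =
  (length u)%:R - 2 * pairing (rho n - rho_S S) (coroot be) + 1 :> rat.

(* An edge is never both Bruhat and quantum, since
   <rho - rho_S, beta^v> > 0 for beta in Delta^+ minus Delta_S^+. *)
Definition QBG_edge n (S : set 'I_n) (la : 'cV[rat]_n) (b : rat)
    (u v : 'M[rat]_n) : Prop :=
  min_reps S u /\ min_reps S v /\
  exists be : 'cV[rat]_n,
    [/\ pos_roots be, ~ pos_roots_S S be, v = floor_S S (u *m refl be) &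
       [\/ is_bruhat u v /\ b * pairing la (coroot be) \is a Num.int,
           [/\ is_quantum S be u v, short_roots be
             & b * pairing la (coroot be) \is a Num.int]
         | [/\ is_quantum S be u v, long_roots be
             & 2 * (b * pairing la (coroot be)) \is a Num.int]]].

(* (x_1, ..., x_s; tau_0, ..., tau_s) is the pair of sequences
   ([:: x_1; ...; x_s], [:: tau_0; ...; tau_s]); with 0-based indexing, x_(i+1)
   and x_i are the items i and i.-1 of the first one.  A path may have length
   zero; s > 0 is forced by tau_0 <> tau_s. *)
Definition LS_paths (T : eqType) (vertex : set T) (edge : rat -> T -> T -> Prop) :
    set (seq T * seq rat) :=
  [set p | [/\ size p.2 = (size p.1).+1,
               head 0 p.2 = 0, last 0 p.2 = 1 & sorted <%R p.2] /\
           (forall x, x \in p.1 -> vertex x) /\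
           (forall (x0 : T) (i : nat), (0 < i < size p.1)%N ->
              clos_refl_trans T (edge p.2`_i)
                (nth x0 p.1 i) (nth x0 p.1 i.-1))].

Definition SiLS n (L : 'cV[rat]_n * rat) :
    set (seq ('M[rat]_n * 'cV[rat]_n) * seq rat) :=
  LS_paths (aff_weyl_S (stab_index L.1)) (SiB_edge (stab_index L.1) L).

Definition QLS n (la : 'cV[rat]_n) : set (seq 'M[rat]_n * seq rat) :=
  LS_paths (min_reps (stab_index la)) (QBG_edge (stab_index la) la).

(* The w in W^S such that x = w z_mu t(mu) with mu in Q^v_{S-adj}. *)
Definition cl_elt n (S : set 'I_n) (x : 'M[rat]_n * 'cV[rat]_n) : 'M[rat]_n :=
  xget 1%:M [set w | min_reps S w /\
    exists2 mu, S_adjusted S mu & x = (w *m zelt S mu, mu)].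

Definition cl n (S : set 'I_n) (p : seq ('M[rat]_n * 'cV[rat]_n) * seq rat) :
    seq 'M[rat]_n * seq rat :=
  ([seq cl_elt S x | x <- p.1], p.2).

(* Main.v *)
(* For a dominant weight [la] let Phi be the set of roots positive on [la], and
   N(w) = #{r in Phi : w r < 0}, the length of the minimal representative of w W_S.
   On W_aff^S the semi-infinite length of w t(mu) is N(w) + 2 <rho - rho_S, mu>, so
   an edge w t(mu) -> w s_g t(mu + k g^v) with g in Phi amounts to
   N(w s_g) - N(w) = 1 - k K, where K = 2 <rho - rho_S, g^v>.  Writing N(w s_g) - N(w)
   and K as sums over all roots and symmetrizing them under s_g gives
   |N(w s_g) - N(w)| <= K - 1 term by term.  Hence k = 0 (a Bruhat edge) or k = 1 (a
   quantum edge), and edges project to edges.  Conversely, for w in W^S the equality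
   cases force w s_g t(k g^v) to lie in W_aff^S, so that every edge lifts, starting
   from any lift of its source.  For g long and k odd the edge is labelled by half a
   long root, which is where the half-integrality on long quantum edges comes from. *)

From HB Require Import structures.
From mathcomp Require Import all_boot all_order all_algebra.
From mathcomp Require Import boolp classical_sets fsbigop.
From mathcomp Require Import finmap cardinality.
From mathcomp Require Import lra zify.
Require Import Defs.

Set Implicit Arguments.
Unset Strict Implicit.
Unset Printing Implicit Defensive.

Import Order.TTheory GRing.Theory Num.Theory.

Local Open Scope classical_set_scope.
Local Open Scope ring_scope.

(** * The pairing and integer vectors *)

(** Reduced words and parabolic data are awkward to compute with, so each is traded for a linear
    condition: W is the group of integral orthogonal matrices, a root is positive when [heights]
    (which is rho) is positive on it, and W_S is the stabilizer of [la], so that Delta_S consists of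
    the roots orthogonal to [la]. Then [ninv la] and [phi_sum la] are invariant under W_S by a
    change of variable, and the factor z_mu disappears from all length computations. The 1 in the
    bound K - 1 comes from g and -g alone, where the pairing with g^v is 2 in absolute value while
    the inversion status changes by only 1. A quantum edge is an equality case of this bound; a
    Bruhat edge is not, and needs a sign argument of its own ([bruhat_stab]). Membership in W_aff^S
    becomes a sign pattern on Delta_S^+ ([aff_min]), and this is what both cases deliver. *)

Lemma pairingC n (x y : 'cV[rat]_n) : pairing x y = pairing y x.
Proof. by apply: eq_bigr => i _; rewrite mulrC. Qed.

Lemma pairing_is_scalable n (y : 'cV[rat]_n) :
  scalable_for *%R (pairing y).
Proof.
by move=> a x; rewrite mulr_sumr; apply: eq_bigr => i _; rewrite mxE mulrCA.
Qed.

Lemma pairing_is_zmod_morphism n (y : 'cV[rat]_n) : zmod_morphism (pairing y).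
Proof.
move=> x z; rewrite -sumrB; apply: eq_bigr => i _.
by rewrite !mxE mulrBr.
Qed.

HB.instance Definition _ n (y : 'cV[rat]_n) :=
  GRing.isZmodMorphism.Build _ _ (pairing y) (pairing_is_zmod_morphism y).

HB.instance Definition _ n (y : 'cV[rat]_n) :=
  GRing.isScalable.Build rat _ rat *%R (pairing y) (pairing_is_scalable y).

Lemma pairingDr n (y x z : 'cV[rat]_n) : pairing y (x + z) = pairing y x + pairing y z.
Proof. exact: linearD. Qed.

Lemma pairingZr n (y x : 'cV[rat]_n) a : pairing y (a *: x) = a * pairing y x.
Proof. exact: linearZ. Qed.

Lemma pairingNr n (y x : 'cV[rat]_n) : pairing y (- x) = - pairing y x.
Proof. exact: linearN. Qed.

Lemma pairing0r n (y : 'cV[rat]_n) : pairing y 0 = 0.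
Proof. exact: linear0. Qed.

Lemma pairingBr n (y x z : 'cV[rat]_n) : pairing y (x - z) = pairing y x - pairing y z.
Proof. exact: linearB. Qed.

Lemma pairing_sumr n (y : 'cV[rat]_n) I (s : seq I) (P : pred I) F :
  pairing y (\sum_(i <- s | P i) F i) = \sum_(i <- s | P i) pairing y (F i).
Proof. exact: linear_sum. Qed.

Lemma pairingDl n (y x z : 'cV[rat]_n) : pairing (x + z) y = pairing x y + pairing z y.
Proof. by rewrite !(pairingC _ y) pairingDr. Qed.

Lemma pairingZl n (y x : 'cV[rat]_n) a : pairing (a *: x) y = a * pairing x y.
Proof. by rewrite !(pairingC _ y) pairingZr. Qed.

Lemma pairingNl n (y x : 'cV[rat]_n) : pairing (- x) y = - pairing x y.
Proof. by rewrite !(pairingC _ y) pairingNr. Qed.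

Lemma pairing0l n (y : 'cV[rat]_n) : pairing 0 y = 0.
Proof. by rewrite pairingC pairing0r. Qed.

Lemma pairingBl n (y x z : 'cV[rat]_n) : pairing (x - z) y = pairing x y - pairing z y.
Proof. by rewrite !(pairingC _ y) pairingBr. Qed.

Lemma pairing_suml n (y : 'cV[rat]_n) I (s : seq I) (P : pred I) F :
  pairing (\sum_(i <- s | P i) F i) y = \sum_(i <- s | P i) pairing (F i) y.
Proof. by rewrite pairingC pairing_sumr; apply: eq_bigr => i _; rewrite pairingC. Qed.

Lemma pairing_mx n (y x : 'cV[rat]_n) : y^T *m x = (pairing y x)%:M.
Proof.
apply/matrixP => i j; rewrite !ord1 !mxE mulr1n.
by apply: eq_bigr => k _; rewrite mxE.
Qed.

Lemma pairing_mull n (w : 'M[rat]_n) (x y : 'cV[rat]_n) :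
  pairing (w *m x) y = pairing x (w^T *m y).
Proof.
have /matrixP/(_ 0 0) : (w *m x)^T *m y = x^T *m (w^T *m y).
  by rewrite trmx_mul mulmxA.
by rewrite !pairing_mx !mxE !mulr1n.
Qed.

Lemma pairing_epsr n (y : 'cV[rat]_n) i : pairing y (eps i) = y i 0.
Proof.
rewrite /pairing (bigD1 i) //= big1 ?addr0 ?mxE ?eqxx ?mulr1 // => j /negbTE ji.
by rewrite mxE ji mulr0.
Qed.

Lemma pairing_xx_eq0 n (x : 'cV[rat]_n) : pairing x x = 0 -> x = 0.
Proof.
move=> /eqP; rewrite psumr_eq0 => [|i _]; last by rewrite -expr2 sqr_ge0.
move=> /allP xx0; apply/matrixP => i j; rewrite ord1 mxE.
by move: (xx0 i (mem_index_enum i)) => /= /eqP/eqP; rewrite mulf_eq0 orbb => /eqP.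
Qed.

Lemma pairing_eps n (i j : 'I_n) : pairing (eps i) (eps j) = (i == j)%:R.
Proof. by rewrite pairing_epsr mxE andbT eq_sym. Qed.

Lemma pairing_eps_norm n (i : 'I_n) : pairing (eps i) (eps i) = 1.
Proof. by rewrite pairing_eps eqxx. Qed.

Lemma coroot_opp n (a : 'cV[rat]_n) : coroot (- a) = - coroot a.
Proof. by rewrite /coroot pairingNl pairingNr opprK scalerN. Qed.

Lemma refl_mul n (a y : 'cV[rat]_n) :
  refl a *m y = y - pairing y (coroot a) *: a.
Proof.
by rewrite /refl mulmxBl mul1mx -mulmxA pairing_mx mul_mx_scalar pairingC.
Qed.

Lemma reflN n (a : 'cV[rat]_n) : refl (- a) = refl a.
Proof. by rewrite /refl coroot_opp linearN /= mulmxN mulNmx opprK. Qed.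

Lemma refl_tr n (a : 'cV[rat]_n) : (refl a)^T = refl a.
Proof.
rewrite /refl linearB /= trmx1 trmx_mul trmxK /coroot linearZ /=.
by rewrite -scalemxAl -scalemxAr.
Qed.

Definition int_vec n (x : 'cV[rat]_n) : Prop := forall i, x i 0 \is a Num.int.

Lemma int_ge1 (x : rat) : x \is a Num.int -> 0 < x -> 1 <= x.
Proof. by case/intrP => k ->; rewrite ltr0z ler1z; lia. Qed.

Lemma int_vec_eps n (i : 'I_n) : int_vec (eps i).
Proof. by move=> j; rewrite mxE andbT; case: eqP. Qed.

Lemma int_vecD n (x y : 'cV[rat]_n) : int_vec x -> int_vec y -> int_vec (x + y).
Proof. by move=> hx hy i; rewrite mxE rpredD. Qed.

Lemma int_vecN n (x : 'cV[rat]_n) : int_vec x -> int_vec (- x).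
Proof. by move=> hx i; rewrite mxE rpredN. Qed.

Lemma int_vecZ n (x : 'cV[rat]_n) a : a \is a Num.int -> int_vec x -> int_vec (a *: x).
Proof. by move=> ha hx i; rewrite mxE rpredM. Qed.

Lemma int_pairing n (x y : 'cV[rat]_n) :
  int_vec x -> int_vec y -> pairing x y \is a Num.int.
Proof. by move=> hx hy; apply: rpred_sum => i _; rewrite rpredM. Qed.

Lemma pairing_xx_ge0 n (x : 'cV[rat]_n) : 0 <= pairing x x.
Proof. by apply: sumr_ge0 => i _; rewrite -expr2 sqr_ge0. Qed.

Lemma vec_neq0 n (x : 'cV[rat]_n) : pairing x x != 0 -> exists i, x i 0 != 0.
Proof.
apply: contraNP => /forallNP x0; suff -> : x = 0 by rewrite pairing0r.
by apply/matrixP => i j; rewrite ord1 mxE; have /negP/negPn/eqP := x0 i.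
Qed.

Lemma pairing_sub_coord n (x : 'cV[rat]_n) i :
  pairing (x - x i 0 *: eps i) (x - x i 0 *: eps i) = pairing x x - x i 0 ^+ 2.
Proof.
rewrite !pairingBr !pairingBl !pairingZr !pairingZl pairing_eps_norm.
by rewrite (pairingC (eps i)) !pairing_epsr; lra.
Qed.

Lemma int_sqr_ge1 (x : rat) : x \is a Num.int -> x != 0 -> 1 <= x ^+ 2.
Proof. by move=> xi x0; rewrite int_ge1 ?rpredX // lt_def sqr_ge0 expf_neq0. Qed.

Lemma unit_sign (x : rat) : x \is a Num.int -> x != 0 -> x ^+ 2 < 4 ->
  exists s : bool, x = (-1) ^+ s.
Proof.
move=> /intrP[k ->] k0; rewrite -rmorphXn /= -[4]/(4%:~R) ltr_int => k4.
have : (k == 1) || (k == -1) by move: k0; rewrite intr_eq0; nia.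
by case/orP => /eqP ->; [exists false|exists true].
Qed.

(** A nonzero integral coordinate already uses up the whole squared norm 1, so removing it leaves
    the zero vector. *)
Lemma int_vec_norm1 n (x : 'cV[rat]_n) : int_vec x -> pairing x x = 1 ->
  exists i (s : bool), x = (-1) ^+ s *: eps i.
Proof.
move=> hx x1; have [|i xi0] := @vec_neq0 _ x; first by rewrite x1.
have xi1 := int_sqr_ge1 (hx i) xi0.
have xx0 := pairing_xx_ge0 (x - x i 0 *: eps i).
have /pairing_xx_eq0/eqP : pairing (x - x i 0 *: eps i) (x - x i 0 *: eps i) = 0.
  by move: xx0; rewrite pairing_sub_coord x1; lra.
rewrite subr_eq0 => /eqP xE; rewrite pairing_sub_coord x1 in xx0.
have [|s xs] := unit_sign (hx i) xi0; first by lra.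
by exists i, s; rewrite -xs.
Qed.

Lemma int_vec_norm2 n (x : 'cV[rat]_n) : int_vec x -> pairing x x = 2 ->
  short_roots x.
Proof.
move=> hx x2; have [|i xi0] := @vec_neq0 _ x; first by rewrite x2.
pose y := x - x i 0 *: eps i.
have yy : pairing y y = 2 - x i 0 ^+ 2 by rewrite pairing_sub_coord x2.
have yy0 := pairing_xx_ge0 y; rewrite yy in yy0.
have [|s xs] := unit_sign (hx i) xi0; first by lra.
have hy : int_vec y by apply/int_vecD => //; apply/int_vecN/int_vecZ/int_vec_eps.
have [|j [t yE]] := int_vec_norm1 hy; first by rewrite yy xs sqrr_sign; lra.
have yi : y i 0 = 0 by rewrite !mxE eqxx mulr1 subrr.
exists i, j, s, t; split.
  apply: contra_eq_neq yi => ->; rewrite yE !mxE eqxx mulr1.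
  by rewrite signr_eq0.
by rewrite -xs -yE addrC subrK.
Qed.

(** This metric description, like the next one, makes the invariance of the roots under integral
    orthogonal matrices immediate. *)
Lemma short_rootsE n (r : 'cV[rat]_n) :
  short_roots r <-> int_vec r /\ pairing r r = 2.
Proof.
split=> [|[]]; last exact: int_vec_norm2.
move=> [i [j [s [t [/negbTE ij ->]]]]]; split.
  by apply: int_vecD; apply: int_vecZ (int_vec_eps _); rewrite rpredX.
rewrite !pairingDr !pairingDl !pairingZr !pairingZl !pairing_eps !eqxx ij.
by rewrite eq_sym ij !mulr0 !mulr1 -!signr_addb !addbb addr0 add0r.
Qed.

(** Integrality and squared norm 4 would not suffice: a vector with four entries equal to 1 or -1
    has them too. Hence the divisibility by 2. *)
Lemma long_rootsE n (r : 'cV[rat]_n) :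
  long_roots r <-> exists x, [/\ int_vec x, pairing x x = 1 & r = 2 *: x].
Proof.
split=> [[i [s ->]]|[x [hx x1 ->]]].
  exists ((-1) ^+ s *: eps i); rewrite !scalerA mulrC; split=> //.
    by apply: int_vecZ (int_vec_eps _); rewrite rpredX.
  by rewrite pairingZr pairingZl pairing_eps_norm mulr1 -signr_addb addbb.
have [i [s ->]] := int_vec_norm1 hx x1.
by exists i, s; rewrite !scalerA mulrC.
Qed.

Lemma long_norm n (r : 'cV[rat]_n) : long_roots r -> pairing r r = 4.
Proof.
by move=> /long_rootsE[x [_ x1 ->]]; rewrite pairingZr pairingZl x1; lra.
Qed.

Lemma roots_cases n (r : 'cV[rat]_n) : roots r ->
  (long_roots r /\ exists x, [/\ int_vec x, pairing x x = 1, coroot r = x,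
     r = 2 *: x & croot r = 2]) \/
  [/\ ~ long_roots r, short_roots r, coroot r = r & croot r = 1].
Proof.
move=> [rl|/[dup] rs /short_rootsE[hr r2]].
  left; split=> //; have [x [hx x1 rE]] := (long_rootsE r).1 rl.
  exists x; rewrite /croot mem_set //; split=> //.
  rewrite /coroot (long_norm rl) {1}rE scalerA -[RHS]scale1r.
  by congr (_ *: _); lra.
have nl : ~ long_roots r by move=> /long_norm; rewrite r2; lra.
right; split=> //; last by rewrite /croot memNset.
by rewrite /coroot r2 divff // scale1r.
Qed.

Lemma short_not_long n (r : 'cV[rat]_n) : short_roots r -> ~ long_roots r.
Proof. by move=> /short_rootsE[_ r2] /long_norm; rewrite r2; lra. Qed.

Lemma croot_coroot n (r : 'cV[rat]_n) : roots r -> (croot r)%:~R *: coroot r = r.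
Proof.
by case/roots_cases => [[_ [x [_ _ -> -> ->]]]|[_ _ -> ->]] //; rewrite scale1r.
Qed.

Lemma root_norm_gt0 n (r : 'cV[rat]_n) : roots r -> 0 < pairing r r.
Proof. by case=> [/long_norm -> //|/short_rootsE[_ ->]]. Qed.

Lemma int_vec_root n (r : 'cV[rat]_n) : roots r -> int_vec r.
Proof.
case=> [/long_rootsE[x [hx _ ->]]|/short_rootsE[]] //.
by apply: int_vecZ.
Qed.

Lemma int_vec_coroot n (r : 'cV[rat]_n) : roots r -> int_vec (coroot r).
Proof.
move=> rr; case/roots_cases: (rr) => [[_ [x [hx _ -> _]]]|[_ _ -> _]] //.
exact: int_vec_root.
Qed.

Lemma int_root_coroot n (r g : 'cV[rat]_n) : roots r -> roots g ->
  pairing r (coroot g) \is a Num.int.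
Proof. by move=> rr rg; apply: int_pairing; [exact: int_vec_root|exact: int_vec_coroot]. Qed.

Lemma pairing_coroot_self n (r : 'cV[rat]_n) : roots r -> pairing r (coroot r) = 2.
Proof.
by move=> /root_norm_gt0 r0; rewrite /coroot pairingZr divfK // gt_eqF.
Qed.

(** * The Weyl group as the group of integral orthogonal matrices *)

(** These are the signed permutation matrices; [weylE] identifies them with W. Closure under product
    and inverse needs no words. *)
Definition int_orth n (w : 'M[rat]_n) : Prop :=
  (forall i j, w i j \is a Num.int) /\ w^T *m w = 1%:M.

Lemma int_orthK n (w : 'M[rat]_n) : int_orth w -> w *m w^T = 1%:M.
Proof. by case=> _ /mulmx1C. Qed.

Lemma int_orth1 n : int_orth (1%:M : 'M[rat]_n).
Proof.
split=> [i j|]; last by rewrite trmx1 mulmx1.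
by rewrite mxE; case: eqP.
Qed.

Lemma int_orthM n (v w : 'M[rat]_n) : int_orth v -> int_orth w -> int_orth (v *m w).
Proof.
move=> [vi vo] [wi wo]; split=> [i j|].
  by rewrite mxE; apply: rpred_sum => k _; rewrite rpredM.
by rewrite trmx_mul mulmxA -(mulmxA w^T) vo mulmx1.
Qed.

Lemma int_orthV n (w : 'M[rat]_n) : int_orth w -> int_orth w^T.
Proof.
move=> wo; split=> [i j|]; last by rewrite trmxK int_orthK.
by rewrite mxE; case: wo.
Qed.

Lemma int_orth_inv n (w : 'M[rat]_n) : int_orth w -> invmx w = w^T.
Proof.
move=> wo; rewrite -[invmx w]mul1mx -wo.2 -mulmxA mulmxV ?mulmx1 //.
by have /mulmx1_unit[] := int_orthK wo.
Qed.

Lemma pairing_orth n (w : 'M[rat]_n) x y : int_orth w ->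
  pairing (w *m x) (w *m y) = pairing x y.
Proof. by move=> [_ wo]; rewrite pairing_mull mulmxA wo mul1mx. Qed.

Lemma int_vec_orth n (w : 'M[rat]_n) x : int_orth w -> int_vec x -> int_vec (w *m x).
Proof. by move=> [wi _] hx i; rewrite mxE; apply: rpred_sum => j _; rewrite rpredM. Qed.

Lemma orth_trK n (w : 'M[rat]_n) (x : 'cV[rat]_n) : int_orth w -> w^T *m (w *m x) = x.
Proof. by move=> [_ wo]; rewrite mulmxA wo mul1mx. Qed.

Lemma orthKtr n (w : 'M[rat]_n) (x : 'cV[rat]_n) : int_orth w -> w *m (w^T *m x) = x.
Proof. by move=> wo; rewrite mulmxA int_orthK ?mul1mx. Qed.

Lemma long_orth n (w : 'M[rat]_n) r : int_orth w -> long_roots r -> long_roots (w *m r).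
Proof.
move=> wo /long_rootsE[x [hx x1 ->]]; apply/long_rootsE; exists (w *m x).
by rewrite -scalemxAr pairing_orth //; split=> //; apply: int_vec_orth.
Qed.

Lemma roots_orth n (w : 'M[rat]_n) r : int_orth w -> roots r -> roots (w *m r).
Proof.
move=> wo [rl|/short_rootsE[hr r2]]; first by left; apply: long_orth.
by right; apply/short_rootsE; rewrite pairing_orth //; split=> //; apply: int_vec_orth.
Qed.

Lemma croot_orth n (w : 'M[rat]_n) r : int_orth w -> croot (w *m r) = croot r.
Proof.
move=> wo; rewrite /croot; suff -> : (w *m r \in @long_roots n) = (r \in @long_roots n) by [].
apply/idP/idP; rewrite !inE; last exact: long_orth.
by move=> /(long_orth (int_orthV wo)); rewrite orth_trK.
Qed.

Lemma coroot_orth n (w : 'M[rat]_n) r : int_orth w -> coroot (w *m r) = w *m coroot r.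
Proof. by move=> wo; rewrite /coroot pairing_orth // scalemxAr. Qed.

Lemma refl_orth n (w : 'M[rat]_n) r : int_orth w -> refl (w *m r) *m w = w *m refl r.
Proof.
move=> wo; rewrite /refl coroot_orth // trmx_mul mulmxBl mulmxBr mul1mx mulmx1.
by rewrite -!mulmxA wo.2 mulmx1.
Qed.

Lemma refl_self n (r : 'cV[rat]_n) : roots r -> refl r *m r = - r.
Proof.
move=> rr; rewrite refl_mul pairing_coroot_self // scaler_nat mulr2n.
by rewrite opprD addrA subrr sub0r.
Qed.

Lemma reflK n (r : 'cV[rat]_n) : roots r -> refl r *m refl r = 1%:M.
Proof.
move=> rr; rewrite {2}/refl mulmxBr mulmx1 mulmxA refl_self // mulNmx opprK.
by rewrite /refl subrK.
Qed.

Lemma int_orth_refl n (r : 'cV[rat]_n) : roots r -> int_orth (refl r).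
Proof.
move=> rr; split=> [i j|]; last by rewrite refl_tr reflK.
rewrite /refl !mxE rpredB //; first by case: eqP.
apply: rpred_sum => k _; rewrite -[_ \in _]/(_ \is a Num.int) ord1 [_^T _ _]mxE.
by apply: rpredM; [exact: int_vec_root|exact: int_vec_coroot].
Qed.

(** * Positivity of roots *)

(** The fundamental weights of type C_n, orthogonal to all simple roots but one. *)
Definition omega n (k : 'I_n) : 'cV[rat]_n := \col_j (j <= k)%:R.

(** The sum of the fundamental weights, that is rho in type C_n. It serves as a regular functional
    whose sign separates positive from negative roots. *)
Definition heights n : 'cV[rat]_n := \col_(i < n) (n - i)%:R.

Definition simple_coef n (k : 'I_n) (y : 'cV[rat]_n) : rat :=
  pairing (omega k) y / (if k.+1 == n then 2 else 1).

Lemma omega_sum n (k : 'I_n) (y : 'cV[rat]_n) :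
  pairing (omega k) y = \sum_(j < n | (j <= k)%N) y j 0.
Proof.
rewrite [RHS]big_mkcond; apply: eq_bigr => j _; rewrite mxE.
by case: ifP; rewrite ?mul1r ?mul0r.
Qed.

(** Summation by parts: [pairing (omega k) y] is a partial sum of the coordinates of y, and
    coordinate j of the right-hand side is the difference of two consecutive partial sums. For j = 0
    the subtracted one is empty. *)
Lemma simple_expansion n (y : 'cV[rat]_n) :
  y = \sum_k simple_coef k y *: simple_root k.
Proof.
apply/matrixP => j c; rewrite ord1 summxE.
have E (k : 'I_n) : (simple_coef k y *: simple_root k) j 0 =
    pairing (omega k) y * (j == k)%:R - pairing (omega k) y * (j == k.+1 :> nat)%:R.
  rewrite /simple_coef !mxE; case: eqP => [kn|_]; last by rewrite divr1 mulrBr.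
  rewrite mulrA divfK //.
  have -> : (j == k.+1 :> nat) = false by rewrite kn ltn_eqF.
  by rewrite mulr0 subr0.
under eq_bigr => k _ do rewrite E.
rewrite sumrB (bigD1 j) //= eqxx mulr1 [X in _ + X - _]big1 => [|k /negbTE kj]; last first.
  by rewrite eq_sym kj mulr0.
rewrite addr0 omega_sum (bigD1 j) //=.
rewrite [X in _ - X](_ : _ = \sum_(k < n | (k <= j)%N && (k != j)) y k 0).
  by rewrite addrK.
case: j E => -[|j] lj E.
  rewrite [RHS]big1 ?big1 // => [k _|k]; first by rewrite mulr0.
  by rewrite -val_eqE /= leqn0 => /andP[->].
rewrite (bigD1 (Ordinal (ltnW lj))) //= eqxx mulr1 big1 ?addr0 => [|k]; last first.
  by rewrite -val_eqE /= eqSS eq_sym => /negbTE ->; rewrite mulr0.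
rewrite omega_sum; apply: eq_bigl => k /=.
by rewrite -val_eqE /= andbC -ltn_neqAle ltnS.
Qed.

Lemma simple_rootP n (i : 'I_n) :
  (i.+1 = n /\ simple_root i = 2 *: eps i) \/
  (exists2 j : 'I_n, j = i.+1 :> nat & simple_root i = eps i - eps j).
Proof.
case: (eqVneq i.+1 n) => [iN|iN].
  left; split=> //; apply/matrixP => j c; rewrite ord1 !mxE iN eqxx andbT.
  by [].
have lt_i : (i.+1 < n)%N by rewrite ltn_neqAle iN ltn_ord.
right; exists (Ordinal lt_i) => //; apply/matrixP => j c.
by rewrite ord1 !mxE (negbTE iN) !andbT.
Qed.

Lemma simple_root_root n (i : 'I_n) : roots (simple_root i).
Proof.
case: (simple_rootP i) => [[_ ->]|[j ji ->]].
  by left; exists i, false; rewrite expr0 scale1r.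
right; exists i, j, false, true; rewrite expr0 expr1 scale1r scaleN1r.
by split=> //; rewrite -val_eqE /= ji ltn_eqF.
Qed.

Lemma omega_simple_root n (k i : 'I_n) :
  k != i -> pairing (omega k) (simple_root i) = 0.
Proof.
move=> ki; case: (simple_rootP i) => [[iN ->]|[j ji ->]].
  rewrite pairingZr pairing_epsr mxE leqNgt; suff -> : (k < i)%N by rewrite mulr0.
  by move: ki (ltn_ord k); rewrite -val_eqE /=; lia.
rewrite pairingBr !pairing_epsr !mxE ji; move: ki; rewrite -val_eqE /= => ki.
by rewrite (_ : (i < k)%N = (i <= k)%N) ?subrr //; lia.
Qed.

Lemma heights_simple_root n (i : 'I_n) : 1 <= pairing (heights n) (simple_root i).
Proof.
case: (simple_rootP i) => [[iN ->]|[j ji ->]].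
  rewrite pairingZr pairing_epsr mxE (_ : (n - i)%N = 1%N) //.
  by lia.
rewrite pairingBr !pairing_epsr !mxE ji -natrB; last by lia.
by rewrite -[1]/(1%:R) ler_nat; move: (ltn_ord j); rewrite ji; lia.
Qed.

(** One normal form for both lengths: i = j with a plus sign gives the long roots. The outer sign s
    alone then decides positivity. *)
Lemma root_form n (r : 'cV[rat]_n) : roots r ->
  exists (s t : bool) (i j : 'I_n),
    [/\ (i <= j)%N, t -> (i < j)%N & r = (-1) ^+ s *: (eps i + (-1) ^+ t *: eps j)].
Proof.
case=> [[i [s ->]]|[i [j [s [t [ij ->]]]]]].
  by exists s, false, i, i; split; rewrite // expr0 scale1r scaler_nat mulr2n.
move: ij; rewrite -val_eqE neq_ltn => /orP[] ij.
  exists s, (s (+) t), i, j; split=> //; first exact: ltnW.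
  by rewrite scalerDr scalerA -signr_addb addKb.
exists t, (t (+) s), j, i; split=> //; first exact: ltnW.
by rewrite scalerDr scalerA -signr_addb addKb addrC.
Qed.

Lemma heights_root_form n (t : bool) (i j : 'I_n) : (i <= j)%N -> (t -> (i < j)%N) ->
  0 < pairing (heights n) (eps i + (-1) ^+ t *: eps j).
Proof.
move=> ij tij; rewrite pairingDr pairingZr !pairing_epsr !mxE.
have j0 : (0 : rat) < (n - j)%:R by rewrite ltr0n subn_gt0.
have ji : ((n - j)%:R : rat) <= (n - i)%:R by rewrite ler_nat leq_sub2l.
case: t tij => [/(_ isT) lij|_]; last by rewrite expr0; lra.
by rewrite expr1 mulN1r subr_gt0 ltr_nat ltn_sub2l.
Qed.

Lemma pos_rootsE n (r : 'cV[rat]_n) :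
  pos_roots r <-> roots r /\ 0 < pairing (heights n) r.
Proof.
split=> [[rr [m rE]]|[rr r0]]; split=> //.
  have m0 : 0 <= pairing (heights n) r.
    rewrite rE pairing_sumr sumr_ge0 // => i _; rewrite pairingZr mulr_ge0 //.
    by apply: le_trans (heights_simple_root i).
  rewrite lt_def m0 andbT; have [s [t [i [j [ij tij ->]]]]] := root_form rr.
  by rewrite pairingZr mulf_neq0 ?signr_eq0 // gt_eqF // heights_root_form.
have [s [t [i [j [ij tij rE]]]]] := root_form rr.
have {s} rE : r = eps i + (-1) ^+ t *: eps j.
  case: s rE => rE; last by rewrite rE expr0 scale1r.
  move: r0; rewrite {}rE expr1 scaleN1r pairingNr oppr_gt0.
  by rewrite ltNge ltW // heights_root_form.
(* The value of [omega k] on the root, a sum or difference of two indicators; at the last index both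
   indicators are 1 and the value is halved, which leaves 1 or 0. *)
pose m (k : 'I_n) : nat := if k.+1 == n then nat_of_bool (~~ t) else
   if t then ((i <= k) - (j <= k))%N else ((i <= k) + (j <= k))%N.
exists m; rewrite [LHS]simple_expansion; apply: eq_bigr => k _; congr (_ *: _).
rewrite /simple_coef rE pairingDr pairingZr !pairing_epsr !mxE /m.
case: eqP => kN.
  have -> : (i <= k)%N by rewrite -ltnS kN.
  have -> : (j <= k)%N by rewrite -ltnS kN.
  by case: (t).
rewrite divr1; case: t tij {rE m} => [/(_ isT) lij|_].
  rewrite expr1 mulN1r natrB //; case: (leqP j k) => // jk.
  by rewrite (leq_trans (ltnW lij) jk).
by rewrite expr0 mul1r natrD.
Qed.

Lemma heights_root_neq0 n (r : 'cV[rat]_n) : roots r -> pairing (heights n) r != 0.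
Proof.
move=> rr; have [s [t [i [j [ij tij ->]]]]] := root_form rr.
by rewrite pairingZr mulf_neq0 ?signr_eq0 // gt_eqF // heights_root_form.
Qed.

Lemma rootsN n (r : 'cV[rat]_n) : roots r -> roots (- r).
Proof. by move=> rr; rewrite -refl_self //; apply: roots_orth => //; apply: int_orth_refl. Qed.

(** * Inversions and length *)

Lemma finite_roots n : finite_set (@roots n).
Proof.
pose f (p : (bool * bool) * ('I_n * 'I_n)) : 'cV[rat]_n :=
  (-1) ^+ p.1.1 *: (eps p.2.1 + (-1) ^+ p.1.2 *: eps p.2.2).
apply: (@sub_finite_set _ _ (f @` setT)); last exact/finite_image/finite_finset.
move=> r /root_form[s [t [i [j [_ _ ->]]]]].
by exists ((s, t), (i, j)).
Qed.

Definition root_list n : seq 'cV[rat]_n := fset_set (@roots n).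

Lemma mem_root_list n (r : 'cV[rat]_n) : (r \in root_list n) <-> roots r.
Proof. by rewrite /root_list in_fset_set ?inE //; apply: finite_roots. Qed.

Lemma root_list_uniq n : uniq (root_list n).
Proof. exact: fset_uniq. Qed.

Lemma sum_roots_orth n (w : 'M[rat]_n) (V : nmodType) (F : 'cV[rat]_n -> V) :
  int_orth w -> \sum_(r <- root_list n) F (w *m r) = \sum_(r <- root_list n) F r.
Proof.
move=> wo; rewrite -(big_map (mulmx w) xpredT F); apply: perm_big.
have inj : injective (mulmx w : 'cV[rat]_n -> _).
  by move=> x y /(congr1 (mulmx w^T)); rewrite !orth_trK.
apply: uniq_perm; rewrite ?map_inj_uniq ?root_list_uniq // => r.
apply/mapP/idP => [[s /mem_root_list rs ->]|/mem_root_list rr].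
  exact/mem_root_list/roots_orth.
exists (w^T *m r); last by rewrite orthKtr.
exact/mem_root_list/roots_orth/rr/int_orthV.
Qed.

Lemma neg_root_neq n (r : 'cV[rat]_n) : roots r -> - r != r.
Proof.
move=> rr; apply: contraTneq (heights_root_neq0 rr) => /(congr1 (pairing (heights n))).
by rewrite pairingNr negbK => /eqP; rewrite eq_sym -addr_eq0 -mulr2n mulrn_eq0.
Qed.

(** Isolates the two roots on which the reflection in a behaves exceptionally. *)
Lemma sum_roots_pair n (a : 'cV[rat]_n) (V : nmodType) (F : 'cV[rat]_n -> V) :
  roots a -> \sum_(r <- root_list n) F r =
  F a + (F (- a) + \sum_(r <- root_list n | (r != a) && (r != - a)) F r).
Proof.
move=> ra; rewrite (bigD1_seq a) ?root_list_uniq //=; last exact/mem_root_list.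
rewrite big_mkcond (bigD1_seq (- a)) ?root_list_uniq //=; last exact/mem_root_list/rootsN.
rewrite neg_root_neq // -big_mkcondr; congr (_ + (_ + _)).
by apply: eq_bigl => r; rewrite andbC.
Qed.

(** For v = [heights n] this is the usual inversion number, for v = la the number N(w). Keeping v as
    a parameter lets a right factor of w be moved onto v ([ninv_mulr]). *)
Definition ninv n (v : 'cV[rat]_n) (w : 'M[rat]_n) : nat :=
  count (fun r => (0 < pairing v r) && (pairing (heights n) (w *m r) < 0)) (root_list n).

Lemma natr_count (T : Type) (P : pred T) (s : seq T) :
  (count P s)%:R = \sum_(x <- s) (P x)%:R :> rat.
Proof.
elim: s => [|x s IHs]; first by rewrite big_nil.
by rewrite big_cons /= natrD IHs.
Qed.

Lemma ninvE n (v : 'cV[rat]_n) w : (ninv v w)%:R =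
  \sum_(r <- root_list n)
    ((0 < pairing v r) && (pairing (heights n) (w *m r) < 0))%:R :> rat.
Proof. exact: natr_count. Qed.

Lemma ninv_mulr n (v : 'cV[rat]_n) w z :
  int_orth z -> ninv v (w *m z) = ninv (z *m v) w.
Proof.
move=> zo; apply/eqP; rewrite -(eqr_nat rat) !ninvE; apply/eqP.
rewrite -[RHS](sum_roots_orth _ zo); apply: eq_bigr => r _.
by rewrite pairing_orth // mulmxA.
Qed.

Lemma root_norm24 n (r : 'cV[rat]_n) : roots r ->
  pairing r r = 2 \/ pairing r r = 4.
Proof. by case=> [/long_norm|/short_rootsE[]]; [right|left]. Qed.

Lemma omega_simple_root_gt0 n (k : 'I_n) : 0 < pairing (omega k) (simple_root k).
Proof.
case: (simple_rootP k) => [[kN ->]|[j jk ->]].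
  by rewrite pairingZr pairing_epsr mxE leqnn.
by rewrite pairingBr !pairing_epsr !mxE jk leqnn ltnn.
Qed.

Lemma omega_sum_simple n (k : 'I_n) (m : 'I_n -> nat) :
  pairing (omega k) (\sum_i (m i)%:R *: simple_root i) =
  (m k)%:R * pairing (omega k) (simple_root k).
Proof.
rewrite pairing_sumr (bigD1 k) //= pairingZr big1 ?addr0 // => i ik.
by rewrite pairingZr omega_simple_root ?mulr0 // eq_sym.
Qed.

(* The reflection only changes the coefficient of [simple_root i], and [r] has
   another positive one. *)
Lemma simple_reflection_pos n (i : 'I_n) r : pos_roots r -> r != simple_root i ->
  0 < pairing (heights n) (refl (simple_root i) *m r).
Proof.
move=> [rr [m rE]] ri; set a := simple_root i in ri *.
have ra : roots a := simple_root_root i.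
have rsr : roots (refl a *m r) by apply: roots_orth => //; apply: int_orth_refl.
have [k ki mk] : exists2 k, k != i & m k != 0%N.
  apply: contra_neqP ri => /forall2NP m0.
  have {}rE : r = (m i)%:R *: a.
    rewrite rE (bigD1 i) //= big1 ?addr0 // => k ki.
    have [/negP|/negP/negPn/eqP->] := m0 k; last by rewrite scale0r.
    by rewrite ki.
  (* Squared norms of roots are 2 or 4, and neither 2 nor 1/2 is the square of a natural number, so
     the factor is 1. *)
  have : pairing r r = (m i ^ 2)%:R * pairing a a.
    by rewrite {1 2}rE pairingZr pairingZl natrX; lra.
  have m1 : (m i = 1 -> r = a)%N by rewrite rE => ->; rewrite scale1r.
  have d1 : (m i ^ 2)%:R * 2 = 2 :> rat -> r = a.
    by rewrite -natrM => /eqP; rewrite eqr_nat => /eqP ?; apply: m1; nia.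
  have d2 : (m i ^ 2)%:R * 4 = 4 :> rat -> r = a.
    by rewrite -natrM => /eqP; rewrite eqr_nat => /eqP ?; apply: m1; nia.
  have d3 : (m i ^ 2)%:R * 2 = 4 :> rat -> r = a.
    by rewrite -natrM => /eqP; rewrite eqr_nat => /eqP ?; apply: m1; nia.
  have d4 : (m i ^ 2)%:R * 4 = 2 :> rat -> r = a.
    by rewrite -natrM => /eqP; rewrite eqr_nat => /eqP ?; apply: m1; nia.
  by case: (root_norm24 rr) => ->; case: (root_norm24 ra) => -> /esym.
rewrite ltNge le_eqVlt negb_or heights_root_neq0 //=; apply/negP => sr0.
have [_ [m' m'E]] : pos_roots (- (refl a *m r)).
  by apply/pos_rootsE; rewrite pairingNr oppr_gt0; split=> //; apply: rootsN.
have := congr1 (pairing (omega k)) m'E; rewrite omega_sum_simple refl_mul opprB.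
rewrite pairingBr (pairingZr (omega k)) (omega_simple_root ki) mulr0 sub0r rE omega_sum_simple.
apply/eqP; rewrite lt_eqF //; apply: (@lt_le_trans _ _ 0); last first.
  by rewrite mulr_ge0 // ltW // omega_simple_root_gt0.
by rewrite oppr_lt0 mulr_gt0 ?omega_simple_root_gt0 // ltr0n lt0n.
Qed.

Lemma simple_root_pos n (i : 'I_n) : pos_roots (simple_root i).
Proof.
apply/pos_rootsE; split; first exact: simple_root_root.
by apply: lt_le_trans (heights_simple_root i).
Qed.

Lemma simple_reflection_sign n (i : 'I_n) r :
  roots r -> r != simple_root i -> r != - simple_root i ->
  (0 < pairing (refl (simple_root i) *m heights n) r) = (0 < pairing (heights n) r).
Proof.
move=> rr ri rNi; rewrite pairing_mull refl_tr; apply/idP/idP => r0; last first.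
  by apply: simple_reflection_pos => //; apply/pos_rootsE.
rewrite ltNge le_eqVlt negb_or heights_root_neq0 //=; apply/negP => rneg.
have : 0 < pairing (heights n) (refl (simple_root i) *m (- r)).
  apply: simple_reflection_pos; last by rewrite eqr_oppLR.
  by apply/pos_rootsE; rewrite pairingNr oppr_gt0; split=> //; apply: rootsN.
by rewrite mulmxN pairingNr oppr_gt0 ltNge ltW.
Qed.

(** The simple reflection preserves the sign of every root other than [a] and [- a], so only these
    two contribute differently on the two sides. *)
Lemma ninv_simple n (w : 'M[rat]_n) i : int_orth w ->
  0 < pairing (heights n) (w *m simple_root i) ->
  ninv (heights n) (w *m refl (simple_root i)) = (ninv (heights n) w).+1.
Proof.
move=> wo wi; set a := simple_root i in wi *.
have ra : roots a := simple_root_root i.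
have a0 : 0 < pairing (heights n) a by case/pos_rootsE: (simple_root_pos i).
apply/eqP; rewrite -(eqr_nat rat) -addn1 natrD ninv_mulr ?ninvE; last exact: int_orth_refl.
rewrite !(sum_roots_pair _ ra) !pairing_mull refl_tr !mulmxN refl_self //.
rewrite opprK !pairingNr !oppr_gt0 !oppr_lt0 a0 (lt_gtF a0) wi (lt_gtF wi) !add0r addrC.
apply/eqP; congr (_ + _); rewrite big_seq_cond [RHS]big_seq_cond.
apply: eq_bigr => r /andP[/mem_root_list rr /andP[ri rNi]].
by rewrite simple_reflection_sign.
Qed.

Lemma ninv_simpleN n (w : 'M[rat]_n) i : int_orth w ->
  pairing (heights n) (w *m simple_root i) < 0 ->
  ninv (heights n) w = (ninv (heights n) (w *m refl (simple_root i))).+1.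
Proof.
move=> wo wi; have ra := simple_root_root i; have so := int_orth_refl ra.
rewrite -(ninv_simple (i := i)); [|exact: int_orthM|].
  by rewrite -mulmxA reflK // mulmx1.
by rewrite -mulmxA refl_self // mulmxN pairingNr oppr_gt0.
Qed.

Lemma ninv_gt0_simple n (w : 'M[rat]_n) : int_orth w -> ninv (heights n) w != 0%N ->
  exists i, pairing (heights n) (w *m simple_root i) < 0.
Proof.
move=> wo; rewrite -lt0n -has_count => /hasP[r /mem_root_list rr /andP[r0 wr]].
have [_ [m rE]] : pos_roots r by apply/pos_rootsE.
apply: contrapT => /forallNP w0; move: wr.
rewrite rE mulmx_sumr pairing_sumr ltNge => /negP; apply.
apply: sumr_ge0 => i _; rewrite -scalemxAr pairingZr mulr_ge0 //.
by rewrite leNgt; apply/negP.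
Qed.

(** A strictly increasing self-map lies above the identity; so does its conjugate by order reversal,
    which puts f below the identity. *)
Lemma incr_ord_id n (f : 'I_n -> 'I_n) :
  {homo f : i j / (i < j)%N} -> forall i, f i = i.
Proof.
have low (g : 'I_n -> 'I_n) : {homo g : i j / (i < j)%N} -> forall i : 'I_n, (i <= g i)%N.
  move=> gi [k]; elim: k => [|k IHk] lk; first by rewrite leq0n.
  exact: leq_ltn_trans (IHk (ltnW lk)) (gi (Ordinal (ltnW lk)) (Ordinal lk) (ltnSn k)).
move=> fi i; apply/val_inj/eqP; rewrite eqn_leq (low f fi) andbT.
have := low (fun i => rev_ord (f (rev_ord i))) _ (rev_ord i).
rewrite rev_ordK /= => /(_ _) low_i; have := ltn_ord (f i); have := ltn_ord i.
have : (n - i.+1 <= n - (f i).+1)%N; last by lia.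
apply: low_i => j k jk /=; have jn := ltn_ord j; have kn := ltn_ord k.
have := fi (rev_ord k) (rev_ord j); rewrite /=.
by have := ltn_ord (f (rev_ord k)); have := ltn_ord (f (rev_ord j)); lia.
Qed.

(** A signed permutation without inversions carries no sign, as seen on the long roots 2 eps_i, and
    preserves the order of the indices, as seen on eps_i - eps_j. *)
Lemma ninv_eq0 n (w : 'M[rat]_n) : int_orth w -> ninv (heights n) w = 0%N -> w = 1%:M.
Proof.
move=> wo w0.
have wpos r : roots r -> 0 < pairing (heights n) r -> 0 < pairing (heights n) (w *m r).
  move=> rr r0; have rwr := roots_orth wo rr.
  rewrite ltNge le_eqVlt negb_or heights_root_neq0 //=.
  apply/negP => wr; suff : (0 < ninv (heights n) w)%N by rewrite w0.
  by rewrite -has_count; apply/hasP; exists r; [exact/mem_root_list|rewrite r0 wr].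
have weps (i : 'I_n) : exists j : 'I_n, w *m eps i = eps j.
  have [||j [s wE]] := @int_vec_norm1 _ (w *m eps i).
  - exact/int_vec_orth/int_vec_eps.
  - by rewrite pairing_orth // pairing_eps_norm.
  exists j; case: s wE => wE; last by rewrite wE scale1r.
  have ri : roots (2 *: eps i) by left; exists i, false; rewrite scale1r.
  have := wpos _ ri; rewrite -scalemxAr wE !pairingZr !pairing_epsr !mxE.
  have i0 : (0 : rat) < (n - i)%:R by rewrite ltr0n subn_gt0.
  have j0 : (0 : rat) < (n - j)%:R by rewrite ltr0n subn_gt0.
  rewrite expr1 mulN1r mulrN oppr_gt0 => /(_ _)/lt_gtF.
  by rewrite !mulr_gt0 // => /(_ isT).
have [f fE] := choice weps.
have /incr_ord_id fid : {homo f : i j / (i < j)%N}.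
  move=> i j ij; have := wpos (eps i - eps j).
  rewrite mulmxBr !fE !pairingBr !pairing_epsr !mxE !subr_gt0 !ltr_nat.
  have H : roots (eps i - eps j).
    right; exists i, j, false, true; rewrite expr0 expr1 scale1r scaleN1r.
    by rewrite -val_eqE /= ltn_eqF.
  move=> /(_ H); have := ltn_ord i; have := ltn_ord j.
  by have := ltn_ord (f i); have := ltn_ord (f j); lia.
apply/matrixP => i j; have /matrixP/(_ i 0) := fE j.
rewrite fid /eps -colE !mxE => ->; by rewrite andbT.
Qed.

(** * Words, stabilizers of dominant weights, and the length function *)

Lemma word_nil n : word [::] = 1%:M :> 'M[rat]_n.
Proof. by rewrite /word big_nil. Qed.

Lemma word_cons n (i : 'I_n) s : word (i :: s) = refl (simple_root i) *m word s.
Proof. by rewrite /word big_cons. Qed.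

Lemma word_rcons n s (i : 'I_n) : word (rcons s i) = word s *m refl (simple_root i).
Proof.
elim: s => [|j s IHs]; first by rewrite word_cons word_nil mulmx1 mul1mx.
by rewrite rcons_cons !word_cons IHs mulmxA.
Qed.

Lemma int_orth_word n (s : seq 'I_n) : int_orth (word s).
Proof.
elim: s => [|i s IHs]; first by rewrite word_nil; apply: int_orth1.
by rewrite word_cons; apply/int_orthM/IHs/int_orth_refl/simple_root_root.
Qed.

Lemma pairing_simple_ge0 n (la : 'cV[rat]_n) i : dominant la ->
  0 <= pairing la (simple_root i).
Proof.
move=> /(_ i); rewrite /coroot pairingZr pmulr_rge0 // divr_gt0 //.
exact/root_norm_gt0/simple_root_root.
Qed.

Lemma stab_indexE n (la : 'cV[rat]_n) i :
  stab_index la i <-> pairing la (simple_root i) = 0.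
Proof.
rewrite /stab_index /= /coroot pairingZr; split=> [/eqP|->]; last by rewrite mulr0.
rewrite mulf_eq0 mulf_eq0 invr_eq0 (gt_eqF (root_norm_gt0 (simple_root_root i))).
by move=> /eqP.
Qed.

Lemma stab_simple n (la : 'cV[rat]_n) i :
  stab_index la i -> refl (simple_root i) *m la = la.
Proof. by rewrite /stab_index /= refl_mul => ->; rewrite scale0r subr0. Qed.

Lemma stab_word n (la : 'cV[rat]_n) s :
  (forall i, i \in s -> stab_index la i) -> word s *m la = la.
Proof.
elim: s => [|i s IHs] si; first by rewrite word_nil mul1mx.
rewrite word_cons -mulmxA IHs => [|j js]; last by apply: si; rewrite inE js orbT.
by apply/stab_simple/si; rewrite mem_head.
Qed.

(* If [w] fixes the dominant weight [la] and [w a < 0] for a simple root [a], then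
   [<la, a> = <la, w a> <= 0], so that [a] is orthogonal to [la]. *)
Lemma int_orth_stab_word n (la : 'cV[rat]_n) w : dominant la -> int_orth w ->
  w *m la = la ->
  exists s, [/\ word s = w, size s = ninv (heights n) w
    & forall i, i \in s -> stab_index la i].
Proof.
move=> la_dom; move: {-1}(ninv _ w) (erefl (ninv (heights n) w)) => k.
elim: k w => [|k IHk] w wk wo wla.
  by exists [::]; split=> //; rewrite word_nil (ninv_eq0 wo).
have [|i wi] := ninv_gt0_simple wo; first by rewrite wk.
have ri := simple_root_root i; have io := int_orth_refl ri.
have la_i : stab_index la i.
  apply/stab_indexE/eqP; rewrite eq_le pairing_simple_ge0 // andbT.
  rewrite -(pairing_orth _ _ wo) wla -[w *m simple_root i]opprK pairingNr oppr_le0.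
  have [_ [m ->]] : pos_roots (- (w *m simple_root i)).
    apply/pos_rootsE; rewrite pairingNr oppr_gt0; split=> //.
    exact/rootsN/roots_orth.
  rewrite pairing_sumr sumr_ge0 // => j _.
  by rewrite pairingZr mulr_ge0 // pairing_simple_ge0.
have /IHk [||s [sE sk sS]] : ninv (heights n) (w *m refl (simple_root i)) = k.
- by apply/eq_add_S; rewrite -ninv_simpleN.
- exact: int_orthM.
- by rewrite -mulmxA stab_simple.
exists (rcons s i); rewrite word_rcons sE -mulmxA reflK // mulmx1 size_rcons sk.
by split=> // j; rewrite mem_rcons inE => /orP[/eqP->|/sS].
Qed.

Lemma dominant0 n : dominant (0 : 'cV[rat]_n).
Proof. by move=> i; rewrite pairing0l. Qed.

(** This is the stabilizer result for the weight 0, which everything fixes. *)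
Lemma weylE n (w : 'M[rat]_n) : weyl w <-> int_orth w.
Proof.
split=> [[s _ <-]|wo]; first exact: int_orth_word.
have [|s [<- _ _]] := int_orth_stab_word (@dominant0 n) wo; first by rewrite mulmx0.
by exists s.
Qed.

(** Turns coset conditions for W_S into the linear equation [z *m la = la]. *)
Lemma weyl_SE n (la : 'cV[rat]_n) z : dominant la ->
  weyl_S (stab_index la) z <-> int_orth z /\ z *m la = la.
Proof.
move=> la_dom; split=> [[s sS <-]|[zo zla]].
  by split; [exact: int_orth_word|exact: stab_word].
by have [s [<- _ sS]] := int_orth_stab_word la_dom zo zla; exists s.
Qed.

Lemma ninv_word n (s : seq 'I_n) : (ninv (heights n) (word s) <= size s)%N.
Proof.
elim/last_ind: s => [|s i IHs].
  rewrite word_nil leqn0 -leqn0 leqNgt -has_count; apply/negP => /hasP[r _].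
  by rewrite mul1mx => /andP[/ltW]; rewrite leNgt => /negbTE ->.
rewrite word_rcons size_rcons; have so := int_orth_word s.
case: (ltgtP (pairing (heights n) (word s *m simple_root i)) 0) => wi.
- by apply/leqW/leq_trans/IHs/ltnW; rewrite [leqRHS](ninv_simpleN so wi).
- by rewrite ninv_simple.
- have := heights_root_neq0 (roots_orth so (simple_root_root i)).
  by rewrite wi eqxx.
Qed.

(** Each letter of a word changes the inversion number by one, so no word is shorter; the word from
    [int_orth_stab_word] attains the bound. *)
Lemma lengthE n (w : 'M[rat]_n) : int_orth w -> length w = ninv (heights n) w.
Proof.
move=> wo; have [|s [sw sk _]] := int_orth_stab_word (@dominant0 n) wo.
  by rewrite mulmx0.
rewrite /length; case: xgetP => [k _ [[t tw <-] tmin]|/(_ (size s)) []].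
  by apply/eqP; rewrite eqn_leq -{1}sk tmin //= -{1}tw ninv_word.
by split=> [|t tw]; [exists s|rewrite sk -tw ninv_word].
Qed.

(** * Minimal coset representatives *)

Lemma pairing_pos_root n (la : 'cV[rat]_n) r : dominant la -> pos_roots r ->
  0 <= pairing la r.
Proof.
move=> la_dom [_ [m ->]]; rewrite pairing_sumr sumr_ge0 // => i _.
by rewrite pairingZr mulr_ge0 // pairing_simple_ge0.
Qed.

Lemma root_pos_or_neg n (r : 'cV[rat]_n) : roots r -> pos_roots r \/ pos_roots (- r).
Proof.
move=> rr; case: (ltP 0 (pairing (heights n) r)) => r0.
  by left; apply/pos_rootsE.
right; apply/pos_rootsE; rewrite pairingNr oppr_gt0; split; first exact: rootsN.
by rewrite lt_neqAle heights_root_neq0.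
Qed.

Lemma pos_of_pairing_gt0 n (la : 'cV[rat]_n) r : dominant la -> roots r ->
  0 < pairing la r -> pos_roots r.
Proof.
move=> la_dom rr r0; case: (root_pos_or_neg rr) => // /(pairing_pos_root la_dom).
by rewrite pairingNr oppr_ge0 leNgt r0.
Qed.

(* The coefficients of a positive root are nonnegative, so orthogonality to a
   dominant weight forces those outside the stabilizer to vanish. *)
Lemma pos_root_stab n (la : 'cV[rat]_n) r : dominant la -> pos_roots r ->
  pairing la r = 0 ->
  exists2 m : 'I_n -> nat, r = \sum_i (m i)%:R *: simple_root i &
    forall i, ~ stab_index la i -> m i = 0%N.
Proof.
move=> la_dom [_ [m rE]] la0; exists m => // i /stab_indexE la_i; apply/eqP.
move: la0; rewrite rE pairing_sumr => /eqP; rewrite psumr_eq0; last first.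
  by move=> j _; rewrite pairingZr mulr_ge0 // pairing_simple_ge0.
move=> /allP/(_ i (mem_index_enum i)); rewrite pairingZr mulf_eq0 pnatr_eq0.
by case/orP => // /eqP.
Qed.

Lemma roots_SE n (la : 'cV[rat]_n) r : dominant la ->
  roots_S (stab_index la) r <-> roots r /\ pairing la r = 0.
Proof.
move=> la_dom; split=> [[rr [m rE]]|[rr la_r]].
  split=> //; rewrite rE pairing_sumr big1 // => i; rewrite inE => /stab_indexE la_i.
  by rewrite pairingZr la_i mulr0.
split=> //=; have pE s : pos_roots s -> pairing la s = 0 -> exists m : 'I_n -> int,
    s = \sum_(i in stab_index la) (m i)%:~R *: simple_root i.
  move=> ps las; have [m -> m0] := pos_root_stab la_dom ps las.
  exists (fun i => m i); rewrite [RHS]big_mkcond; apply: eq_bigr => i _.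
  by case: ifPn => //; rewrite notin_setE => /m0 ->; rewrite scale0r.
case: (root_pos_or_neg rr) => /pE; first by apply.
rewrite pairingNr la_r oppr0 => /(_ erefl)[m rE]; exists (fun i => - m i).
rewrite -[LHS]opprK rE -sumrN; apply: eq_bigr => i _.
by rewrite mulrNz scaleNr.
Qed.

Lemma pos_roots_SE n (la : 'cV[rat]_n) r : dominant la ->
  pos_roots_S (stab_index la) r <-> pos_roots r /\ pairing la r = 0.
Proof.
move=> la_dom; split=> [[/(roots_SE _ la_dom)[]]|[pr la_r]] //.
by split=> //; apply/roots_SE => //; split=> //; case: pr.
Qed.

(** The root criterion for minimality in w W_S; see [min_repsE]. *)
Definition stab_pos n (la : 'cV[rat]_n) (w : 'M[rat]_n) : Prop :=
  forall r, pos_roots r -> pairing la r = 0 -> 0 < pairing (heights n) (w *m r).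

(** Inversions are sorted by their value on [la]: a root positive on [la] is automatically positive,
    and no positive root is negative on [la]. *)
Lemma ninv_split n (la : 'cV[rat]_n) w : dominant la ->
  (ninv (heights n) w)%:R = (ninv la w)%:R +
  \sum_(r <- root_list n) [&& 0 < pairing (heights n) r, pairing la r == 0
     & pairing (heights n) (w *m r) < 0]%:R :> rat.
Proof.
move=> la_dom; rewrite !ninvE -big_split /= big_seq [RHS]big_seq.
apply: eq_bigr => r /mem_root_list rr.
case: (ltgtP 0 (pairing la r)) => la_r.
- have /pos_rootsE[_ ->] := pos_of_pairing_gt0 la_dom rr la_r.
  by rewrite /= addr0.
- case: ltP => //= r0; have := pairing_pos_root la_dom ((pos_rootsE r).2 (conj rr r0)).
  by rewrite leNgt la_r.
- by rewrite /= add0r.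
Qed.

Lemma ninv_stab_pos n (la : 'cV[rat]_n) w : dominant la -> stab_pos la w ->
  ninv (heights n) w = ninv la w.
Proof.
move=> la_dom wpos; apply/eqP; rewrite -(eqr_nat rat) (ninv_split w la_dom).
rewrite big_seq big1 ?addr0 // => r /mem_root_list rr.
case: (ltP 0 (pairing (heights n) r)) => //= r0; case: eqP => //= la_r.
by rewrite lt_gtF //; apply: wpos => //; apply/pos_rootsE.
Qed.

Lemma leq_ninv n (la : 'cV[rat]_n) w : dominant la ->
  (ninv la w <= ninv (heights n) w)%N.
Proof.
move=> la_dom; rewrite -(ler_nat rat) (ninv_split w la_dom) lerDl.
by apply: sumr_ge0.
Qed.

Lemma ninv_mul_stab n (la : 'cV[rat]_n) w z : int_orth z -> z *m la = la ->
  ninv la (w *m z) = ninv la w.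
Proof. by move=> zo zla; rewrite ninv_mulr // zla. Qed.

Lemma stab_tr n (la : 'cV[rat]_n) z : int_orth z -> z *m la = la -> z^T *m la = la.
Proof. by move=> zo zla; rewrite -{1}zla orth_trK. Qed.

Lemma pairing_stab n (la : 'cV[rat]_n) z r : int_orth z -> z *m la = la ->
  pairing la (z *m r) = pairing la r.
Proof. by move=> zo zla; rewrite -{1}zla pairing_orth. Qed.

(** z has no inversions. Off the hyperplane orthogonal to [la] they are counted by [ninv la z],
    which is [ninv la 1], hence 0. On it, if r > 0 and z r < 0, then u sends - z r to a positive
    root, against the positivity of u z r. *)
Lemma stab_pos_unique n (la : 'cV[rat]_n) u z : dominant la -> int_orth u ->
  int_orth z -> z *m la = la -> stab_pos la u -> stab_pos la (u *m z) -> z = 1%:M.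
Proof.
move=> la_dom uo zo zla upos uzpos; apply: ninv_eq0 => //.
rewrite (@ninv_stab_pos _ la) //; last first.
  move=> r pr la_r; have rzr : roots (z *m r) by apply: roots_orth => //; case: pr.
  case: (root_pos_or_neg rzr) => [/pos_rootsE[]|/upos] //.
  rewrite pairingNr pairing_stab // la_r oppr0 => /(_ erefl).
  rewrite mulmxN pairingNr oppr_gt0 mulmxA => /lt_gtF.
  by rewrite uzpos.
rewrite -[z]mul1mx ninv_mul_stab // -(@ninv_stab_pos _ la) //.
  by apply/eqP; rewrite -leqn0 -(word_nil n) ninv_word.
by move=> r /pos_rootsE[_ r0] _; rewrite mul1mx.
Qed.

Lemma coset_SE n (la : 'cV[rat]_n) w v : dominant la ->
  coset_S (stab_index la) w v <-> exists z, [/\ int_orth z, z *m la = la & v = w *m z].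
Proof.
move=> la_dom; split=> [[z /(weyl_SE _ la_dom)[zo zla] <-]|[z [zo zla ->]]].
  by exists z.
by exists z => //; apply/weyl_SE.
Qed.

(** If v made a simple root of S negative, multiplying by that reflection would shorten v inside the
    coset. Conversely, [ninv la] is constant on the coset and bounds every length from below, with
    equality under [stab_pos]. *)
Lemma min_in_cosetE n (la : 'cV[rat]_n) w v : dominant la -> int_orth w ->
  is_min_in_coset (stab_index la) w v <->
  (exists z, [/\ int_orth z, z *m la = la & v = w *m z]) /\ stab_pos la v.
Proof.
move=> la_dom wo; split=> [[/(coset_SE _ _ la_dom)[z [zo zla vE]] vmin]|[vz vpos]].
  have vo : int_orth v by rewrite vE; apply: int_orthM.
  split; first by exists z.
  move=> r pr la_r; have [m rE m0] := pos_root_stab la_dom pr la_r.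
  have rr : roots r by case: pr.
  have rvr := roots_orth vo rr.
  rewrite lt_def heights_root_neq0 //= rE mulmx_sumr pairing_sumr sumr_ge0 // => i _.
  rewrite -scalemxAr pairingZr; case: (pselect (stab_index la i)) => [Si|/m0->]; last first.
    by rewrite mul0r.
  rewrite mulr_ge0 // leNgt; apply/negP => vi.
  have io := int_orth_refl (simple_root_root i).
  have := vmin (v *m refl (simple_root i)); rewrite !lengthE //; last exact: int_orthM.
  rewrite (ninv_simpleN vo vi) ltnn => vi_min; suff /vi_min :
    coset_S (stab_index la) w (v *m refl (simple_root i)) by [].
  apply/coset_SE => //.
  exists (z *m refl (simple_root i)); rewrite vE mulmxA; split=> //.
    exact: int_orthM.
  by rewrite -mulmxA stab_simple.
have [z [zo zla vE]] := vz; have vo : int_orth v by rewrite vE; apply: int_orthM.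
split; first exact/coset_SE.
move=> v' /(coset_SE _ _ la_dom)[z' [zo' zla' v'E]].
have v'o : int_orth v' by rewrite v'E; apply: int_orthM.
rewrite !lengthE // (ninv_stab_pos la_dom vpos); apply: leq_trans (leq_ninv _ la_dom).
by rewrite vE v'E !ninv_mul_stab.
Qed.

Lemma min_repsE n (la : 'cV[rat]_n) w : dominant la ->
  min_reps (stab_index la) w <-> int_orth w /\ stab_pos la w.
Proof.
move=> la_dom; split=> [[/weylE wo /(min_in_cosetE _ la_dom wo)[]]|[wo wpos]] //.
split; first exact/weylE.
apply/min_in_cosetE => //; split=> //; exists 1%:M; split; first exact: int_orth1.
  by rewrite mul1mx.
by rewrite mulmx1.
Qed.

Lemma floor_SE n (la : 'cV[rat]_n) u z : dominant la -> int_orth u ->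
  stab_pos la u -> int_orth z -> z *m la = la ->
  floor_S (stab_index la) (u *m z) = u.
Proof.
move=> la_dom uo upos zo zla; have uzo := int_orthM uo zo.
rewrite /floor_S; case: xgetP => [v _ /(min_in_cosetE _ la_dom uzo)[[z' [zo' zla' vE]] vpos]|].
  rewrite vE -mulmxA (@stab_pos_unique _ la u (z *m z')) ?mulmx1 //.
  - exact: int_orthM.
  - by rewrite -mulmxA zla' zla.
  - by rewrite mulmxA -vE.
move=> /(_ u) []; apply/min_in_cosetE => //; split=> //.
exists z^T; split; [exact: int_orthV|exact: stab_tr|].
by rewrite -mulmxA int_orthK // mulmx1.
Qed.

Lemma floor_S_spec n (la : 'cV[rat]_n) w : dominant la -> int_orth w ->
  let u := floor_S (stab_index la) w in
  [/\ int_orth u, stab_pos la u & exists z, [/\ int_orth z, z *m la = la & w = u *m z]].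
Proof.
move=> la_dom wo; rewrite /floor_S; case: xgetP => [u _|nomin].
  move=> /(min_in_cosetE _ la_dom wo)[[z [zo zla ->]] upos].
  split=> //; first exact: int_orthM.
  exists z^T; split; [exact: int_orthV|exact: stab_tr|].
  by rewrite -mulmxA int_orthK // mulmx1.
(* The default of [xget] is never reached: the lengths in the coset are natural numbers and have a
   minimum. *)
have [k kP kmin] : exists2 k, (exists2 v, coset_S (stab_index la) w v & length v = k) &
    forall v, coset_S (stab_index la) w v -> (k <= length v)%N.
  pose P k := `[< exists2 v, coset_S (stab_index la) w v & length v = k >].
  have exP : exists k, P k.
    exists (length w); apply/asboolP; exists w => //; apply/coset_SE => //.
    exists 1%:M; rewrite mul1mx mulmx1; split=> //; exact: int_orth1.
  case: (ex_minnP exP) => k /asboolP kP kmin; exists k => // v vc.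
  by apply/kmin/asboolP; exists v.
case: kP => v vc vk; case: (nomin v); split=> // v' /kmin; by rewrite vk.
Qed.

(** * The reflection inequality *)

(** For dominant [la] this is 2 <rho - rho_S, x>, by [rho_diff_pairing]. *)
Definition phi_sum n (la x : 'cV[rat]_n) : rat :=
  \sum_(r <- root_list n | 0 < pairing la r) pairing r x.

Lemma phi_sumD n (la x y : 'cV[rat]_n) :
  phi_sum la (x + y) = phi_sum la x + phi_sum la y.
Proof. by rewrite -big_split; apply: eq_bigr => r _; rewrite pairingDr. Qed.

Lemma phi_sumZ n (la x : 'cV[rat]_n) a : phi_sum la (a *: x) = a * phi_sum la x.
Proof. by rewrite mulr_sumr; apply: eq_bigr => r _; rewrite pairingZr. Qed.

Lemma phi_sum_stab n (la x : 'cV[rat]_n) z : int_orth z -> z *m la = la ->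
  phi_sum la (z *m x) = phi_sum la x.
Proof.
move=> zo zla; rewrite /phi_sum big_mkcond [RHS]big_mkcond -(sum_roots_orth _ zo).
by apply: eq_bigr => r _; rewrite pairing_stab // pairing_orth.
Qed.

(** The reflection in g fixes [la] and negates the coroot, so the value equals its own opposite. *)
Lemma phi_sum_orthogonal n (la g : 'cV[rat]_n) : roots g -> pairing la g = 0 ->
  phi_sum la (coroot g) = 0.
Proof.
move=> rg la_g; have sla : refl g *m la = la.
  by rewrite refl_mul /coroot pairingZr la_g mulr0 scale0r subr0.
have := phi_sum_stab (coroot g) (int_orth_refl rg) sla.
rewrite -coroot_orth ?refl_self ?coroot_opp -?scaleN1r ?phi_sumZ //; first lra.
exact: int_orth_refl.
Qed.

Lemma sum_roots_eq0 n (P : pred 'cV[rat]_n) (F : 'cV[rat]_n -> rat) :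
  (forall r, roots r -> P r -> 0 <= F r) ->
  \sum_(r <- root_list n | P r) F r = 0 -> forall r, roots r -> P r -> F r = 0.
Proof.
move=> F0 /eqP; rewrite big_seq_cond psumr_eq0; last first.
  by move=> r /andP[/mem_root_list]; exact: F0.
move=> /allP sum0 r /mem_root_list rr Pr; apply/eqP.
by have := sum0 r rr; rewrite rr Pr.
Qed.

Section ReflectionInequality.
Variables (n : nat) (la g : 'cV[rat]_n) (u : 'M[rat]_n).
Hypotheses (uo : int_orth u) (rg : roots g) (la_g : 0 < pairing la g).

Let s := refl g.
Let so : int_orth s := int_orth_refl rg.

(** f antisymmetrizes the indicator of Phi, e is the change of inversion status and c the pairing
    with g^v. All three are odd under s. *)
Let f (r : 'cV[rat]_n) : rat := (0 < pairing la r)%R%:R - (0 < pairing la (s *m r))%R%:R.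
Let e (r : 'cV[rat]_n) : rat := (pairing (heights n) (u *m (s *m r)) < 0)%R%:R
  - (pairing (heights n) (u *m r) < 0)%R%:R.
Let c (r : 'cV[rat]_n) : rat := pairing r (coroot g).

Let sK (r : 'cV[rat]_n) : s *m (s *m r) = r.
Proof. by rewrite mulmxA reflK // mul1mx. Qed.

Let cs (r : 'cV[rat]_n) : c (s *m r) = - c r.
Proof.
by rewrite /c pairing_mull refl_tr -coroot_orth // refl_self // coroot_opp pairingNr.
Qed.

Let es (r : 'cV[rat]_n) : e (s *m r) = - e r.
Proof. by rewrite /e sK opprB. Qed.

(** Half of the left-hand side is rewritten by the substitution of s r for r, which moves the
    oddness of F onto the indicator. *)
Let sum_anti (F : 'cV[rat]_n -> rat) : (forall r, F (s *m r) = - F r) ->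
  2 * (\sum_(r <- root_list n) (0 < pairing la r)%R%:R * F r) =
  \sum_(r <- root_list n) f r * F r.
Proof.
move=> FN; rewrite mulr2n mulrDl mul1r.
under [RHS]eq_bigr => r _ do rewrite mulrBl.
rewrite sumrB; congr (_ + _).
rewrite -[X in _ = - X](sum_roots_orth _ so) -sumrN.
by apply: eq_bigr => r _; rewrite sK FN mulrN opprK.
Qed.

Let phi_f : 2 * phi_sum la (coroot g) = \sum_(r <- root_list n) f r * c r.
Proof.
rewrite -(sum_anti cs) /phi_sum big_mkcond; congr (_ * _).
by apply: eq_bigr => r _; rewrite mulr_natl mulrb.
Qed.

Let ninv_f : 2 * ((ninv la (u *m s))%:R - (ninv la u)%:R) =
  \sum_(r <- root_list n) f r * e r.
Proof.
rewrite -(sum_anti es) !ninvE -sumrB; congr (_ * _).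
apply: eq_bigr => r _; rewrite /e mulmxA.
by case: (0 < pairing la r); rewrite /= ?mul1r ?mul0r ?subrr.
Qed.

(** s lowers the value on [la] by c r times [pairing la g]. Leaving or entering the positive side
    therefore fixes the sign of the integer c r. *)
Let fP (r : 'cV[rat]_n) : roots r ->
  [\/ f r = 0, f r = 1 /\ 1 <= c r | f r = -1 /\ c r <= -1].
Proof.
move=> rr; have ci : c r \is a Num.int := int_root_coroot rr rg.
have las : pairing la (s *m r) = pairing la r - c r * pairing la g.
  by rewrite refl_mul pairingBr pairingZr.
rewrite /f las; case: (ltP 0 (pairing la r)) => lr; case: ltP => lsr.
- by rewrite subrr; constructor 1.
- constructor 2; rewrite subr0; split=> //; apply: int_ge1 => //.
  by rewrite -(pmulr_lgt0 _ la_g); lra.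
- constructor 3; rewrite sub0r; split=> //; rewrite lerNr int_ge1 ?rpredN //.
  by rewrite -(pmulr_lgt0 _ la_g); lra.
- by rewrite subrr; constructor 1.
Qed.

Let eP (r : 'cV[rat]_n) : -1 <= e r <= 1.
Proof. by rewrite /e; case: ltP => _; case: ltP => _. Qed.

Let fg : f g = 1.
Proof. by rewrite /f refl_self // pairingNr oppr_gt0 la_g (lt_gtF la_g) subr0. Qed.

Let fgN : f (- g) = -1.
Proof.
by rewrite /f mulmxN refl_self // opprK pairingNr oppr_gt0 la_g (lt_gtF la_g) sub0r.
Qed.

Let cgN : c (- g) = - 2.
Proof. by rewrite /c pairingNl pairing_coroot_self. Qed.

Let egN : e (- g) = - e g.
Proof. by rewrite -es /s refl_self. Qed.

Let eg : e g = 1 /\ 0 < pairing (heights n) (u *m g) \/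
         e g = -1 /\ pairing (heights n) (u *m g) < 0.
Proof.
rewrite /e refl_self // mulmxN pairingNr oppr_lt0.
case: ltgtP (heights_root_neq0 (roots_orth uo rg)) => //= ug _.
- by left; rewrite subr0.
- by right; rewrite sub0r.
Qed.

(** The values t = 1 and t = -1 give the two bounds. The isolated contribution of g and -g is at
    least 2 because |e g| is at most 1; after halving, this is the 1 in both bounds. *)
Let sum_pm (t : rat) :
  2 * phi_sum la (coroot g) + t * (2 * ((ninv la (u *m s))%:R - (ninv la u)%:R)) =
  2 * (2 + t * e g) +
  \sum_(r <- root_list n | (r != g) && (r != - g)) f r * (c r + t * e r).
Proof.
rewrite phi_f ninv_f mulr_sumr -big_split /= (sum_roots_pair _ rg) fg fgN cgN egN.
rewrite addrA; congr (_ + _).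
  by rewrite /c pairing_coroot_self //; lra.
by apply: eq_bigr => r _; lra.
Qed.

(** Where f r is nonzero, c r has the sign of f r and absolute value at least 1, so t e r cannot
    outweigh it. *)
Let term_ge0 (r : 'cV[rat]_n) (t : rat) : roots r -> -1 <= t <= 1 -> 0 <= f r * (c r + t * e r).
Proof.
move=> rr /andP[t1 t2]; have /andP[e1 e2] := eP r.
have te : -1 <= t * e r <= 1 by nra.
by case: (fP rr) => [->|[-> ?]|[-> ?]]; nra.
Qed.

Let rest_ge0 (t : rat) : -1 <= t <= 1 ->
  0 <= \sum_(r <- root_list n | (r != g) && (r != - g)) f r * (c r + t * e r).
Proof.
move=> t1; rewrite big_seq_cond sumr_ge0 // => r /andP[/mem_root_list rr _].
exact: term_ge0.
Qed.

Lemma ninv_refl_bounds :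
  1 - phi_sum la (coroot g) <= (ninv la (u *m s))%:R - (ninv la u)%:R
    <= phi_sum la (coroot g) - 1.
Proof.
have /andP[e1 e2] := eP g; apply/andP; split.
  by have := rest_ge0 (t := 1); have := sum_pm 1; lra.
by have := rest_ge0 (t := -1); have := sum_pm (-1); lra.
Qed.

Lemma stab_neq (r : 'cV[rat]_n) : pairing la r = 0 -> (r != g) && (r != - g).
Proof.
move=> lr; apply/andP; split; apply: contra_eq_neq lr => ->.
  by rewrite gt_eqF.
by rewrite pairingNr oppr_eq0 gt_eqF.
Qed.

Let f_stab (r : 'cV[rat]_n) : pairing la r = 0 -> f r = - (c r < 0)%R%:R.
Proof.
move=> lr; rewrite /f lr ltxx sub0r refl_mul pairingBr pairingZr lr sub0r oppr_gt0.
by rewrite pmulr_llt0.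
Qed.

(* Equality in [ninv_refl_bounds] makes every term of the symmetrized sum vanish
   except those of [g] and [- g]. *)
Lemma quantum_stab : stab_pos la u ->
  (ninv la (u *m s))%:R = (ninv la u)%:R - phi_sum la (coroot g) + 1 :> rat ->
  forall r, pos_roots r -> pairing la r = 0 ->
  (pairing r (coroot g) = 0 /\ 0 < pairing (heights n) (u *m s *m r)) \/
  (pairing r (coroot g) = -1 /\ pairing (heights n) (u *m s *m r) < 0).
Proof.
move=> upos D.
have rest0 : \sum_(r <- root_list n | (r != g) && (r != - g)) f r * (c r + 1 * e r) = 0.
  have := rest_ge0 (t := 1); have := sum_pm 1; have /andP[e1 e2] := eP g; lra.
have term0 r : roots r -> pairing la r = 0 -> c r < 0 -> c r = - e r.
  move=> rr lr cr; have t1 : -1 <= (1 : rat) <= 1 by [].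
  have := sum_roots_eq0 (fun q rq _ => term_ge0 rq t1) rest0 rr (stab_neq lr).
  by rewrite (f_stab lr) cr /=; lra.
move=> r /[dup] pr [rr _] lr; have ur := upos r pr lr.
have ci : c r \is a Num.int := int_root_coroot rr rg.
rewrite -mulmxA -/(c r); case: (ltgtP (c r) 0) => cr.
- right; have := term0 r rr lr cr; rewrite /e (lt_gtF ur) subr0.
  by case: ltP => /= _ cE; [split=> //; lra|lra].
- have : c (- r) = - e (- r).
    apply: term0; rewrite ?pairingNr ?lr ?oppr0 //; first exact: rootsN.
    by rewrite /c pairingNl oppr_lt0.
  rewrite /c pairingNl -/(c r) /e !mulmxN !pairingNr !oppr_lt0 ur.
  by move=> crE; exfalso; move: crE; case: ltP => /= _; lra.
- left; split=> //; rewrite refl_mul -/(c r) cr scale0r subr0 //.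
Qed.

(** By [husr], all products f r * e r have the sign of u g or vanish. Their total is 2, which rules
    out u g < 0. For u g > 0 the roots g and -g already account for 2, so all other products vanish;
    an r in Delta_S^+ with u s r < 0 would make the product at - r equal to 1. *)
Lemma bruhat_stab : stab_pos la u -> ninv la (u *m s) = (ninv la u).+1 ->
  stab_pos la (u *m s) /\ 0 < pairing (heights n) (u *m g).
Proof.
move=> upos D; have {}D : (ninv la (u *m s))%:R - (ninv la u)%:R = 1 :> rat.
  by rewrite D -addn1 natrD addrAC subrr add0r.
have husr r : pairing (heights n) (u *m (s *m r)) =
    pairing (heights n) (u *m r) - c r * pairing (heights n) (u *m g).
  by rewrite refl_mul mulmxBr -scalemxAr pairingBr pairingZr.
have sumE : 2 = 2 * e g +
    \sum_(r <- root_list n | (r != g) && (r != - g)) f r * e r.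
  have := ninv_f; rewrite D mulr1 => fe2; rewrite [LHS]fe2 (sum_roots_pair _ rg) fg fgN egN addrA.
  by congr (_ + _); lra.
have [[eg1 ug]|[eg1 ug]] := eg; last first.
  have : \sum_(r <- root_list n | (r != g) && (r != - g)) f r * e r <= 0.
    rewrite big_seq_cond -oppr_ge0 -sumrN sumr_ge0 // => r /andP[/mem_root_list rr _].
    rewrite oppr_ge0 /e husr; case: (fP rr) => [->|[-> cr]|[-> cr]]; first by rewrite mul0r.
      by case: ltP => h1; case: ltP => h2 //=; nra.
    by case: ltP => h1; case: ltP => h2 //=; nra.
  by lra.
split=> // r /[dup] pr [rr _] lr; have ur := upos r pr lr.
rewrite -mulmxA ltNge; apply/negP => sr.
have {}sr : pairing (heights n) (u *m (s *m r)) < 0.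
  by rewrite lt_neqAle sr heights_root_neq0 //; do 2 apply: roots_orth => //.
have fe r' : roots r' -> 0 <= f r' * e r'.
  move=> rr'; rewrite /e husr; case: (fP rr') => [->|[-> cr]|[-> cr]].
  - by rewrite mul0r.
  - by case: ltP => h1; case: ltP => h2 //=; nra.
  - by case: ltP => h1; case: ltP => h2 //=; nra.
have rest0 : \sum_(q <- root_list n | (q != g) && (q != - g)) f q * e q = 0 by lra.
have lrN : pairing la (- r) = 0 by rewrite pairingNr lr oppr0.
have cr : c (- r) < 0.
  by rewrite /c pairingNl oppr_lt0 -/(c r); move: sr; rewrite husr; nra.
have := sum_roots_eq0 (fun q rq _ => fe q rq) rest0 (rootsN rr) (stab_neq lrN).
rewrite (f_stab lrN) cr /e !mulmxN !pairingNr !oppr_lt0 ur (lt_gtF sr) /=.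
by lra.
Qed.

End ReflectionInequality.

(** Any u shows it: the two bounds enclose the same number, so 1 - K is at most K - 1. *)
Lemma phi_sum_coroot_gt0 n (la g : 'cV[rat]_n) : roots g -> 0 < pairing la g ->
  0 < phi_sum la (coroot g).
Proof. by move=> rg lg; have /andP := ninv_refl_bounds 1%:M rg lg; lra. Qed.

(** * The affine Weyl group *)

Lemma fsum_roots n (A : set 'cV[rat]_n) (P : pred 'cV[rat]_n) :
  (forall r, A r <-> roots r /\ P r) ->
  \sum_(a \in A) a = \sum_(a <- root_list n | P a) a.
Proof.
move=> AP; have -> : A = [set` [seq r <- root_list n | P r]].
  apply/seteqP; split=> r /=; rewrite mem_filter.
    by move=> /AP[/mem_root_list -> ->].
  by move=> /andP[Pr /mem_root_list rr]; apply/AP.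
by rewrite -fsbig_seq ?filter_uniq ?root_list_uniq // big_filter.
Qed.

Lemma rho_pairing n (x : 'cV[rat]_n) : 2 * pairing (rho n) x =
  \sum_(r <- root_list n | 0 < pairing (heights n) r) pairing r x.
Proof.
rewrite /rho pairingZl mulrA mulfV // mul1r (fsum_roots (@pos_rootsE n)).
by rewrite pairing_suml.
Qed.

Lemma rho_S_pairing n (la x : 'cV[rat]_n) : dominant la ->
  2 * pairing (rho_S (stab_index la)) x =
  \sum_(r <- root_list n | (0 < pairing (heights n) r) && (pairing la r == 0)) pairing r x.
Proof.
move=> la_dom; rewrite /rho_S pairingZl mulrA mulfV // mul1r -pairing_suml.
rewrite (@fsum_roots _ _ (fun r => (0 < pairing (heights n) r) && (pairing la r == 0))) //.
move=> r; split=> [/(pos_roots_SE _ la_dom)[/pos_rootsE[rr r0] /eqP lr]|[rr /andP[r0 /eqP lr]]].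
  by rewrite r0 lr.
by apply/pos_roots_SE => //; split=> //; apply/pos_rootsE.
Qed.

Lemma sum_pos_split n (la x : 'cV[rat]_n) : dominant la ->
  \sum_(r <- root_list n | 0 < pairing (heights n) r) pairing r x = phi_sum la x +
  \sum_(r <- root_list n | (0 < pairing (heights n) r) && (pairing la r == 0)) pairing r x.
Proof.
move=> la_dom; rewrite (bigID (fun r => pairing la r == 0)) /= addrC; congr (_ + _).
rewrite /phi_sum big_seq_cond [RHS]big_seq_cond; apply: eq_bigl => r.
apply/andb_id2l => /mem_root_list rr; apply/andP/idP => [[r0 lr]|lr].
  by rewrite lt_def lr pairing_pos_root //; apply/pos_rootsE.
by rewrite gt_eqF //; split=> //; case/pos_rootsE: (pos_of_pairing_gt0 la_dom rr lr).
Qed.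

Lemma rho_diff_pairing n (la x : 'cV[rat]_n) : dominant la ->
  2 * pairing (rho n - rho_S (stab_index la)) x = phi_sum la x.
Proof.
move=> la_dom; rewrite pairingBl mulrBr rho_pairing rho_S_pairing //.
by rewrite (sum_pos_split x la_dom) addrK.
Qed.

Lemma int_vec_sum n I (s : seq I) (F : I -> 'cV[rat]_n) :
  (forall i, int_vec (F i)) -> int_vec (\sum_(i <- s) F i).
Proof.
move=> F_int; elim/big_ind: _ => // [i|x y]; last exact: int_vecD.
by rewrite mxE.
Qed.

Lemma simple_coef_coroot n (k : 'I_n) (x : 'cV[rat]_n) :
  simple_coef k x *: simple_root k = pairing (omega k) x *: coroot (simple_root k).
Proof.
rewrite /simple_coef /coroot scalerA; congr (_ *: _).
case: (simple_rootP k) => [[kN ->]|[j jk ->]].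
  rewrite kN eqxx pairingZr pairingZl pairing_eps_norm; congr (_ * _).
have -> : (k.+1 == n) = false by rewrite -jk ltn_eqF.
have kj : (k == j) = false by rewrite -val_eqE /= jk ltn_eqF.
rewrite pairingBr !pairingBl !pairing_eps !eqxx (eq_sym j) kj.
by congr (_ * _).
Qed.

(** Over the simple coroots the coefficients are the partial sums [pairing (omega k) x], without the
    factor 1/2 that the long simple root would require. *)
Lemma coroot_latticeE n (x : 'cV[rat]_n) : coroot_lattice x <-> int_vec x.
Proof.
split=> [[m ->]|hx].
  apply: int_vec_sum => i; apply: int_vecZ; first exact: intr_int.
  exact/int_vec_coroot/simple_root_root.
have /choice[m mE] : forall k, exists m : int, pairing (omega k) x = m%:~R.
  move=> k; apply/intrP/int_pairing => // j; rewrite mxE.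
  by case: leqP.
exists m; rewrite [LHS]simple_expansion; apply: eq_bigr => k _.
by rewrite simple_coef_coroot mE.
Qed.

(** * The action on affine roots and membership in W_aff^S *)

Lemma croot_cases n (r : 'cV[rat]_n) : roots r ->
  (croot r = 2 /\ long_roots r) \/ (croot r = 1 /\ short_roots r).
Proof. by case/roots_cases => [[rl [x []]]|[]]; [left|right]. Qed.

(** Since c_r r^v = r, a long root pairs evenly with the coroot lattice. The integer k is the amount
    by which t(mu) shifts the label of an affine root over r. *)
Lemma root_pairing n (r mu : 'cV[rat]_n) : roots r -> int_vec mu ->
  exists k : int, pairing r mu = (croot r * k)%:~R.
Proof.
move=> rr hmu; have /intrP[k kE] := int_pairing (int_vec_coroot rr) hmu.
by exists k; rewrite -{1}(croot_coroot rr) pairingZl kE intrM.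
Qed.

Lemma aff_act_full n (w : 'M[rat]_n) mu r (a k : int) : int_orth w ->
  pairing r mu = (croot r * k)%:~R ->
  aff_act (w, mu) (aff_vec (AffFull r a)) = aff_vec (AffFull (w *m r) (a - k)).
Proof.
by move=> wo kE; rewrite /aff_act /= kE croot_orth // mulrBr intrB.
Qed.

Lemma aff_act_half n (w : 'M[rat]_n) mu r (a k : int) : int_orth w -> croot r = 2 ->
  pairing r mu = (croot r * k)%:~R ->
  aff_act (w, mu) (aff_vec (AffHalf r a)) = aff_vec (AffHalf (w *m r) (a - k)).
Proof.
move=> wo r2 kE; rewrite /aff_act /= pairingZl kE r2 -scalemxAr; congr (_, _).
by rewrite !(intrB, intrM); lra.
Qed.

Lemma aff_pos_full n (r : 'cV[rat]_n) (a : int) : roots r ->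
  aff_pos_roots (aff_vec (AffFull r a)) <-> 0 < a \/ (a = 0 /\ pos_roots r).
Proof.
move=> rr; rewrite /aff_pos_roots /= ltr0z.
have c0 : 0 < croot r by case: (croot_cases rr) => -[->].
rewrite pmulr_rgt0 //; split=> [[[_ a0]|[pr /eqP]]|[a0|[-> pr]]].
- by left.
- by rewrite intr_eq0 mulf_eq0 gt_eqF //= => /eqP; right.
- by left; split=> //; exists (AffFull r a).
- by right; rewrite mulr0.
Qed.

Lemma aff_pos_half n (r : 'cV[rat]_n) (a : int) : long_roots r ->
  aff_pos_roots (aff_vec (AffHalf r a)) <-> 0 < a.
Proof.
move=> rl; rewrite /aff_pos_roots /= pmulr_rgt0 // ltr0z.
split=> [[[_]|[_ /eqP]]|a0]; first by lia.
  by rewrite mulf_eq0 intr_eq0 /=; lia.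
by left; split; [exists (AffHalf r a)|lia].
Qed.

(** mu is S-adjusted, and w makes negative exactly those roots of Delta_S^+ on which mu takes the
    value -1. *)
Definition aff_min n (la : 'cV[rat]_n) (w : 'M[rat]_n) (mu : 'cV[rat]_n) : Prop :=
  forall r, pos_roots r -> pairing la r = 0 ->
    (pairing r mu = 0 /\ 0 < pairing (heights n) (w *m r)) \/
    (pairing r mu = -1 /\ pairing (heights n) (w *m r) < 0).

(** Two affine roots decide each r. Applied to r itself, the condition gives k <= 0, with w r > 0 if
    k = 0. A lower bound comes from - r + delta for r short, where k = -1 forces w r < 0, and from
    half of - r + delta for r long, where it excludes k = -1. *)
Lemma aff_weyl_S_min n (la : 'cV[rat]_n) w mu : dominant la ->
  aff_weyl_S (stab_index la) (w, mu) -> [/\ int_orth w, int_vec mu & aff_min la w mu].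
Proof.
move=> la_dom [[/= /weylE wo /coroot_latticeE hmu] wS]; split=> // r pr lr.
have rr : roots r by case: pr.
have rS : roots_S (stab_index la) r by apply/roots_SE.
have rNS : roots_S (stab_index la) (- r).
  by apply/roots_SE => //; rewrite pairingNr lr oppr0; split=> //; apply: rootsN.
have [k kE] := root_pairing rr hmu; have rwr := roots_orth wo rr.
have test b : is_aff_root b -> roots_S (stab_index la) (label_root b) ->
    aff_pos_roots (aff_vec b) -> aff_pos_roots (aff_act (w, mu) (aff_vec b)).
  by move=> bb bS b0; apply: wS; split=> //; exists b.
have test_r : 0 < - k \/ (- k = 0 /\ pos_roots (w *m r)).
  apply/(aff_pos_full _ rwr); rewrite -sub0r -(aff_act_full _ wo kE).
  by apply: test => //; apply/aff_pos_full => //; right.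
have k_le0 : k <= 0 by case: test_r => [|[]]; lia.
have k0 : k = 0 -> pairing r mu = 0 /\ 0 < pairing (heights n) (w *m r).
  move=> k0; case: test_r => [|[_ /pos_rootsE[_ ->]]]; first by rewrite k0.
  by rewrite kE k0 mulr0.
have kEN : pairing (- r) mu = (croot (- r) * - k)%:~R.
  rewrite pairingNl kE mulrN -(refl_self rr) croot_orth ?mulrNz //.
  exact: int_orth_refl.
have rwNr : roots (w *m - r) by rewrite mulmxN; apply: rootsN.
case: (croot_cases rr) => -[r2 rl]; [left|].
  have rNl : long_roots (- r).
    by rewrite -refl_self //; apply: long_orth => //; apply: int_orth_refl.
  apply: k0; suff : 0 < 1 + k by lia.
  have wNl : long_roots (w *m - r) by apply: long_orth.
  rewrite -[k]opprK -(aff_pos_half _ wNl) -(aff_act_half _ wo _ kEN); last first.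
    by rewrite /croot mem_set.
  by apply: test => //; apply/aff_pos_half.
have [||k1] : [\/ k = 0, 0 < 1 + k | 1 + k = 0 /\ pos_roots (w *m - r)].
- have : 0 < 1 + k \/ (1 + k = 0 /\ pos_roots (w *m - r)); last first.
    by case; [constructor 2|constructor 3].
  rewrite -[k]opprK; apply/(aff_pos_full _ rwNr); rewrite -(aff_act_full _ wo kEN).
  by apply: test => //; [exact: rootsN|apply/aff_pos_full; [exact: rootsN|left]].
- by left; apply: k0.
- by move=> k1; left; apply: k0; lia.
right; case: k1 => k1 /pos_rootsE[_]; rewrite mulmxN pairingNr oppr_gt0 => ->.
by rewrite kE r2 mul1r; split=> //; have -> : k = -1 by lia.
Qed.

Lemma aff_min_weyl_S n (la : 'cV[rat]_n) w mu : dominant la ->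
  int_orth w -> int_vec mu -> aff_min la w mu -> aff_weyl_S (stab_index la) (w, mu).
Proof.
move=> la_dom wo hmu wS; split.
  by split=> /=; [exact/weylE|exact/coroot_latticeE].
move=> x [b0 [b [bb /(roots_SE _ la_dom)[rr lr]] bE]].
move: b0; rewrite -{}bE {x} => b0.
have [k kE] := root_pairing rr hmu; have rwr := roots_orth wo rr.
(* The shift k for a root of either sign. Length matters only for k = 1: the half root with a = 1
   would then be sent to a nonpositive one, but a long root cannot pair to 1. *)
have kP : (pos_roots (label_root b) /\
      (k = 0 /\ 0 < pairing (heights n) (w *m label_root b) \/ k = -1)) \/
    (pos_roots (- label_root b) /\
      (k = 0 \/ [/\ k = 1, croot (label_root b) = 1 &
        0 < pairing (heights n) (w *m label_root b)])).
  have cE : croot (label_root b) = 2 \/ croot (label_root b) = 1.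
    by case: (croot_cases rr) => -[]; [left|right].
  case: (root_pos_or_neg rr) => pr; [left|right]; split=> //.
    case: (wS _ pr lr) => -[]; rewrite kE => /eqP.
      by rewrite intr_eq0 => k0 wr; left; split=> //; case: cE k0 => ->; lia.
    by rewrite -[-1]/((-1)%:~R) eqr_int => k1 _; right; case: cE k1 => ->; lia.
  have lrN : pairing la (- label_root b) = 0 by rewrite pairingNr lr oppr0.
  case: (wS _ pr lrN) => -[]; rewrite pairingNl kE => /eqP.
    by rewrite oppr_eq0 intr_eq0 => k0 wr; left; case: cE k0 => ->; lia.
  rewrite eqr_opp -[1]/(1%:~R) eqr_int mulmxN pairingNr oppr_lt0 => k1 wr.
  by right; case: cE k1 => -> k1; split=> //; lia.
case: b bb b0 rr lr kE rwr kP => r a /= rl b0 rr lr kE rwr kP.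
  rewrite (aff_act_full _ wo kE); apply/aff_pos_full => //.
  move: b0 => /(aff_pos_full _ rr) b0; rewrite (pos_rootsE (w *m r)).
  case: kP => [[pr [[-> wr]|->]]|[pr kP]].
  - by rewrite subr0; case: b0 => [|[]]; [left|right].
  - by left; case: b0 => [|[]]; lia.
  have a0 : 0 < a.
    case: b0 => // -[_ /pos_rootsE[_ r0]]; move/pos_rootsE: pr => -[_].
    by rewrite pairingNr oppr_gt0 => /lt_gtF; rewrite r0.
  case: kP => [->|[-> _ wr]]; first by rewrite subr0; left.
  by case: (ltgtP a 1) => a1; [lia|left; lia|right; rewrite a1 subrr].
have r2 : croot r = 2 by rewrite /croot mem_set.
rewrite (aff_act_half _ wo r2 kE); apply/aff_pos_half; first exact: long_orth.
move/(aff_pos_half _ rl): b0 => a0.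
by case: kP => [[_ [[-> _]|->]]|[_ [->|[_]]]]; [lia|lia|lia|rewrite r2].
Qed.

(** Concerns the product of v t(nu) and z t(mu). If z r < 0, then mu contributes -1 and nu,
    evaluated on z r, contributes 0 or 1, so the total is again -1 or 0 with the right sign. *)
Lemma aff_min_stab n (la : 'cV[rat]_n) v z nu mu : int_orth z -> z *m la = la ->
  aff_min la v nu -> aff_min la z mu -> aff_min la (v *m z) (z^T *m nu + mu).
Proof.
move=> zo zla vS zS r pr lr; have rr : roots r by case: pr.
have rz := roots_orth zo rr.
have lz : pairing la (z *m r) = 0 by rewrite pairing_stab.
rewrite pairingDr -mulmxA -pairing_mull.
case: (zS r pr lr) => -[-> zr].
  have pz : pos_roots (z *m r) by apply/pos_rootsE.
  by rewrite addr0; apply: vS.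
have pz : pos_roots (- (z *m r)).
  by apply/pos_rootsE; rewrite pairingNr oppr_gt0; split=> //; apply: rootsN.
have := vS _ pz; rewrite pairingNr lz oppr0 => /(_ erefl).
rewrite mulmxN pairingNr pairingNl oppr_gt0 oppr_lt0.
by case=> -[? ?]; [right|left]; split=> //; lra.
Qed.

(** Minimality of u means that u preserves the sign of roots orthogonal to [la], so u z and z have
    the same signs on Delta_S. *)
Lemma aff_min_factor n (la : 'cV[rat]_n) u z mu : dominant la -> stab_pos la u ->
  int_orth u -> int_orth z -> z *m la = la ->
  aff_min la (u *m z) mu -> aff_min la z mu.
Proof.
move=> la_dom upos uo zo zla uzS r pr lr; have rr : roots r by case: pr.
have rz := roots_orth zo rr.
have lz : pairing la (z *m r) = 0 by rewrite pairing_stab.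
have zsign : (0 < pairing (heights n) (u *m (z *m r))) = (0 < pairing (heights n) (z *m r)).
  case: (root_pos_or_neg rz) => /[dup] /pos_rootsE[_ z0] pz.
    by rewrite upos.
  have : 0 < pairing (heights n) (u *m (- (z *m r))).
    by apply: upos; rewrite // pairingNr lz oppr0.
  move: z0; rewrite mulmxN !pairingNr !oppr_gt0 => z0 uz0.
  by rewrite (lt_gtF z0) (lt_gtF uz0).
have h0 := heights_root_neq0 rz; have h1 := heights_root_neq0 (roots_orth uo rz).
case: (uzS r pr lr) => -[rmu]; rewrite -mulmxA => ur; [left|right]; split=> //.
  by rewrite -zsign.
by rewrite lt_neqAle h0 leNgt -zsign (lt_gtF ur).
Qed.

(** mu prescribes the signs of z and z' on Delta_S, so z z'^-1 preserves positivity there and is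
    trivial. *)
Lemma aff_min_unique n (la : 'cV[rat]_n) z z' mu : dominant la ->
  int_orth z -> z *m la = la -> int_orth z' -> z' *m la = la ->
  aff_min la z mu -> aff_min la z' mu -> z = z'.
Proof.
move=> la_dom zo zla zo' zla' zS zS'.
have sgn r : roots r -> pairing la r = 0 ->
    0 < pairing (heights n) (z' *m r) -> 0 < pairing (heights n) (z *m r).
  move=> rr lr; case: (root_pos_or_neg rr) => pr.
    by move: (zS r pr lr) (zS' r pr lr) => [[? ?]|[? ?]] [[? ?]|[? ?]] // ?; lra.
  have lrN : pairing la (- r) = 0 by rewrite pairingNr lr oppr0.
  move: (zS _ pr lrN) (zS' _ pr lrN); rewrite !mulmxN !pairingNr !oppr_gt0 !oppr_lt0.
  by move=> [[? ?]|[? ?]] [[? ?]|[? ?]] // ?; lra.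
have o : int_orth (z *m z'^T) by apply/int_orthM/int_orthV.
have : z *m z'^T = 1%:M.
  apply: (stab_pos_unique la_dom (int_orth1 n) o).
  - by rewrite -mulmxA stab_tr.
  - by move=> r /pos_rootsE[_ r0] _; rewrite mul1mx.
  move=> r /pos_rootsE[rr r0] lr; rewrite mul1mx -mulmxA; apply: sgn.
  - exact/roots_orth/rr/int_orthV.
  - by rewrite pairing_stab ?stab_tr //; apply: int_orthV.
  - by rewrite orthKtr.
by move/(congr1 (mulmx^~ z')); rewrite -mulmxA zo'.2 mulmx1 mul1mx.
Qed.

(** * Projection and lifting of edges *)

Lemma floor_S_mulr n (la : 'cV[rat]_n) w z : dominant la -> int_orth w ->
  int_orth z -> z *m la = la ->
  floor_S (stab_index la) (w *m z) = floor_S (stab_index la) w.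
Proof.
move=> la_dom wo zo zla; have [uo upos [z' [zo' zla' {1}->]]] := floor_S_spec la_dom wo.
rewrite -mulmxA floor_SE //; first exact: int_orthM.
by rewrite -mulmxA zla zla'.
Qed.

Lemma floor_S_min n (la : 'cV[rat]_n) w : dominant la -> int_orth w ->
  min_reps (stab_index la) (floor_S (stab_index la) w).
Proof. by move=> la_dom wo; have [uo upos _] := floor_S_spec la_dom wo; apply/min_repsE. Qed.

Lemma length_floor_S n (la : 'cV[rat]_n) w : dominant la -> int_orth w ->
  length (floor_S (stab_index la) w) = ninv la w.
Proof.
move=> la_dom wo; have [uo upos [z [zo zla {2}->]]] := floor_S_spec la_dom wo.
by rewrite lengthE // (ninv_stab_pos la_dom upos) ninv_mul_stab.
Qed.

(** Write w = u z with u minimal. The sign conditions pass to z, which makes it z_mu by uniqueness;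
    cancelling z then determines the W^S-factor. No [xget] default is used. *)
Lemma cl_eltE n (la : 'cV[rat]_n) x : dominant la -> aff_weyl_S (stab_index la) x ->
  cl_elt (stab_index la) x = floor_S (stab_index la) x.1.
Proof.
case: x => w mu la_dom wS; have [wo hmu wmin] := aff_weyl_S_min la_dom wS.
have [uo upos [z [zo zla wE]]] := floor_S_spec la_dom wo.
set u := floor_S _ _ in uo upos wE *.
have zmin : aff_min la z mu by apply: (aff_min_factor la_dom upos) => //; rewrite -wE.
have zeltE : zelt (stab_index la) mu = z.
  apply: xget_unique => [|z' /= [/(weyl_SE _ la_dom)[zo' zla'] z'S]].
    by split; [exact/weyl_SE|exact: aff_min_weyl_S].
  have [_ _ z'min] := aff_weyl_S_min la_dom z'S.
  exact: (aff_min_unique la_dom zo' zla' zo zla z'min zmin).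
apply: xget_unique => /= [|w' [_ [mu' _ [wE' muE]]]].
  split; first exact/min_repsE.
  exists mu; last by rewrite zeltE -wE.
  split; first exact/coroot_latticeE.
  move=> r /(pos_roots_SE _ la_dom)[pr lr].
  by case: (zmin r pr lr) => -[]; [left|right].
move: wE'; rewrite -muE zeltE wE => /(congr1 (mulmx^~ z^T)).
by rewrite -!mulmxA (int_orthK zo) !mulmx1.
Qed.

(** Each root of Delta_S^+ contributes its pairing with mu plus 1 if w makes it negative, and
    [aff_min] says that this is 0. *)
Lemma si_lengthE n (la : 'cV[rat]_n) w mu : dominant la ->
  aff_weyl_S (stab_index la) (w, mu) ->
  si_length (w, mu) = (ninv la w)%:R + phi_sum la mu.
Proof.
move=> la_dom wS; have [wo hmu wmin] := aff_weyl_S_min la_dom wS.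
rewrite /si_length /= lengthE // rho_pairing (sum_pos_split mu la_dom).
rewrite (ninv_split w la_dom) addrACA -[RHS]addr0; congr (_ + _).
rewrite [X in _ + X]big_mkcond -big_split big_seq big1 //= => r /mem_root_list rr.
case: ltP => //= r0; case: eqP => //= lr; rewrite ?addr0 //.
have pr : pos_roots r by apply/pos_rootsE.
by case: (wmin r pr lr) => -[->]; [move/lt_gtF->|move=> ->]; rewrite ?addr0 ?subrr.
Qed.

Lemma refl_stab n (la g : 'cV[rat]_n) : pairing la g = 0 -> refl g *m la = la.
Proof. by move=> lg; rewrite refl_mul /coroot pairingZr lg mulr0 scale0r subr0. Qed.

(* Integrality for the edge that multiplies [w t(mu)] on the right by [s_g t(k g^v)]. *)
Definition edge_int n (b : rat) (la g : 'cV[rat]_n) (k : int) : Prop :=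
  b * pairing la (coroot g) \is a Num.int \/
  [/\ long_roots g, k != 0 & 2 * (b * pairing la (coroot g)) \is a Num.int].

(** Left multiplication by s_beta is right multiplication by the reflection in x^-1 beta, whose
    finite part is g. Half roots give k = 2a - 1, odd and so nonzero, and their doubled pairing
    gives the factor 2. *)
Lemma SiB_edge_right n (S : set 'I_n) (L : 'cV[rat]_n * rat) b w mu y : int_orth w ->
  SiB_edge S L b (w, mu) y ->
  exists (g : 'cV[rat]_n) (k : int), [/\ roots g,
    y = (w *m refl g, mu + k%:~R *: coroot g) & edge_int b L.1 g k].
Proof.
move=> wo [_ _ _ [be [rbe _ -> bint]]].
have refl_w r : refl r *m w = w *m refl (w^T *m r).
  by rewrite -refl_orth // orthKtr.
have cor r (k : rat) : invmx w *m (k *: coroot r) = k *: coroot (w^T *m r).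
  by rewrite int_orth_inv // -scalemxAr coroot_orth //; apply: int_orthV.
have pair r : pairing (w *m L.1) (coroot r) = pairing L.1 (coroot (w^T *m r)).
  by rewrite pairing_mull coroot_orth //; apply: int_orthV.
case: be rbe bint => r a /= rr; rewrite pair => bint.
  exists (w^T *m r), (a * croot r); split.
  - exact/roots_orth/rr/int_orthV.
  - by rewrite /aff_mul /= refl_w cor addrC.
  - by left.
have rl : long_roots (w^T *m r) by exact/long_orth/rr/int_orthV.
exists (w^T *m r), (2 * a - 1); split; first by left.
- by rewrite /aff_mul /= refl_w cor addrC.
- by right; split=> //; [lia|rewrite mulrCA].
Qed.

Lemma edge_intN n b (la g : 'cV[rat]_n) k : edge_int b la g k -> edge_int b la (- g) (- k).
Proof.
rewrite /edge_int coroot_opp pairingNr !mulrN !rpredN oppr_eq0.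
case=> [|[gl k0 bint]]; [by left|right; split=> //].
by have := long_orth (int_orth_refl (or_introl gl : roots g)) gl; rewrite refl_self //; left.
Qed.

(** The pairs (g, k) and (-g, -k) describe the same edge, so g may be taken positive on [la], after
    which the reflection bounds leave only k = 0 and k = 1. *)
Lemma SiB_edge_pos n (L : 'cV[rat]_n * rat) b w mu y : dominant L.1 ->
  SiB_edge (stab_index L.1) L b (w, mu) y ->
  exists (g : 'cV[rat]_n) (k : bool), [/\ roots g, 0 < pairing L.1 g,
    y = (w *m refl g, mu + k%:R *: coroot g), edge_int b L.1 g k &
    (ninv L.1 (w *m refl g))%:R = (ninv L.1 w)%:R + 1 - k%:R * phi_sum L.1 (coroot g) :> rat].
Proof.
set la := L.1 => la_dom /[dup] [[xS yS len _]] xy; have [wo _ _] := aff_weyl_S_min la_dom xS.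
have [g0 [k0 [rg0 y0 b0]]] := SiB_edge_right wo xy.
have N0 : (ninv la (w *m refl g0))%:R =
    (ninv la w)%:R + 1 - k0%:~R * phi_sum la (coroot g0) :> rat.
  move: len; rewrite y0 in yS *; rewrite !(si_lengthE la_dom) // phi_sumD phi_sumZ.
  lra.
have [g [k [rg lg yE bint N]]] : exists (g : 'cV[rat]_n) (k : int),
    [/\ roots g, 0 < pairing la g, y = (w *m refl g, mu + k%:~R *: coroot g),
      edge_int b la g k &
      (ninv la (w *m refl g))%:R = (ninv la w)%:R + 1 - k%:~R * phi_sum la (coroot g) :> rat].
  case: (ltgtP 0 (pairing la g0)) => lg0.
  - by exists g0, k0.
  - exists (- g0), (- k0); rewrite reflN coroot_opp pairingNr oppr_gt0.
    have phiN : phi_sum la (- coroot g0) = - phi_sum la (coroot g0).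
      by rewrite -scaleN1r phi_sumZ mulN1r.
    rewrite phiN mulrNz scaleNr scalerN opprK mulrNN.
    by split=> //; [exact: rootsN|exact: edge_intN].
  (* Here g is orthogonal to [la]: neither N nor the translation part of the length changes, so the
     length cannot grow by 1. *)
  - move: N0; rewrite phi_sum_orthogonal // ninv_mul_stab ?refl_stab //; first lra.
    exact: int_orth_refl.
have /andP[lo hi] := ninv_refl_bounds w rg lg.
have phi0 := phi_sum_coroot_gt0 rg lg.
have : (k == 0) || (k == 1).
  case: (ltgtP k 1) => // k1; last by rewrite orbT.
    case: (ltgtP k 0) => // k2; exfalso; last by lia.
    have : k%:~R <= -1 :> rat by rewrite -[-1]/((-1)%:~R) ler_int; lia.
    by rewrite -(ler_pM2r phi0); lra.
  have : 2 <= k%:~R :> rat by rewrite -[2]/(2%:~R) ler_int; lia.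
  by rewrite -(ler_pM2r phi0); lra.
by case/orP => /eqP kE; rewrite kE in yE bint N; exists g; [exists false|exists true].
Qed.

Lemma SiB_edge_cl n (L : 'cV[rat]_n * rat) b x y : dominant L.1 ->
  SiB_edge (stab_index L.1) L b x y ->
  QBG_edge (stab_index L.1) L.1 b (cl_elt (stab_index L.1) x) (cl_elt (stab_index L.1) y).
Proof.
case: x => w mu; set la := L.1 => la_dom /[dup] [[xS yS _ _]].
move=> /(SiB_edge_pos la_dom)[g [k [rg lg yE bint N]]].
have [wo _ _] := aff_weyl_S_min la_dom xS.
rewrite !cl_eltE //= yE /=; have wgo := int_orthM wo (int_orth_refl rg).
split; first exact: floor_S_min.
split; first exact: floor_S_min.
have [uo upos [z [zo zla wE]]] := floor_S_spec la_dom wo.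
set u := floor_S _ w in uo upos wE *.
have zg := roots_orth zo rg; have lzg : 0 < pairing la (z *m g) by rewrite pairing_stab.
have corE : pairing la (coroot (z *m g)) = pairing la (coroot g).
  by rewrite coroot_orth // pairing_stab.
have lenE : length (floor_S (stab_index la) (w *m refl g)) = ninv la (w *m refl g).
  exact: length_floor_S.
have lenu : length u = ninv la w by apply: length_floor_S.
(* From w = u z, the product w s_g is u s_(z g) z, so the edge leaving u is labelled by z g. *)
exists (z *m g); split.
- exact: pos_of_pairing_gt0.
- by move=> /(pos_roots_SE _ la_dom)[_ l0]; rewrite l0 ltxx in lzg.
- rewrite {1}wE -mulmxA -refl_orth // mulmxA floor_S_mulr //.
  exact/int_orthM/int_orth_refl.
rewrite corE /is_bruhat /is_quantum lenE lenu (rho_diff_pairing _ la_dom) coroot_orth //.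
rewrite (phi_sum_stab _ zo zla).
case: k bint N {yE} => /= bint N.
  have {}N : (ninv la (w *m refl g))%:R = (ninv la w)%:R - phi_sum la (coroot g) + 1 :> rat.
    by rewrite N; lra.
  case: bint => [bint|[gl _ bint]].
    (* [edge_int] does not record the parity of k, so a long root may occur here; integrality
       implies the half-integrality asked of it. *)
    case: (zg) => [zl|zs]; [constructor 3; split=> //|by constructor 2].
    by rewrite rpredM.
  by constructor 3; split=> //; apply: long_orth.
constructor 1; split.
  by apply/eqP; rewrite -(eqr_nat rat) -addn1 natrD N; apply/eqP; lra.
by case: bint => // -[].
Qed.

(** With x = u z t(mu), the target is u s_g t(k g^v) followed by z t(mu). The first factor has the
    [aff_min] pattern by [bruhat_stab] or [quantum_stab], and [aff_min_stab] carries it to the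
    product. *)
Lemma QBG_edge_lift n (L : 'cV[rat]_n * rat) b x u v : dominant L.1 ->
  aff_weyl_S (stab_index L.1) x -> cl_elt (stab_index L.1) x = u ->
  QBG_edge (stab_index L.1) L.1 b u v ->
  exists y, SiB_edge (stab_index L.1) L b x y /\ cl_elt (stab_index L.1) y = v.
Proof.
case: x => w mu; set la := L.1 => la_dom xS; rewrite cl_eltE //= => uE.
have [wo hmu wmin] := aff_weyl_S_min la_dom xS.
have [uo upos [z [zo zla wE]]] := floor_S_spec la_dom wo; rewrite {}uE in uo upos wE.
move=> [_ [_ [g [pg gS vE gcase]]]]; have rg : roots g by case: pg.
have lg : 0 < pairing la g.
  rewrite lt_def pairing_pos_root // andbT; apply/eqP => lg.
  by apply: gS; apply/pos_roots_SE.
have ugo : int_orth (u *m refl g) by apply/int_orthM/int_orth_refl.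
have lenv : length v = ninv la (u *m refl g) by rewrite vE length_floor_S.
have lenu : length u = ninv la u by rewrite lengthE // (ninv_stab_pos la_dom upos).
have zmin : aff_min la z mu by apply: (aff_min_factor la_dom upos) => //; rewrite -wE.
have lift (be : aff_label n) (k : rat) : k \is a Num.int ->
    aff_refl be = (refl (u *m g), k *: coroot (u *m g)) ->
    is_aff_root be -> aff_pos_roots (aff_vec be) ->
    b * aff_pairing (aff_act (w, mu) L) be \is a Num.int ->
    aff_min la (u *m refl g) (k *: coroot g) ->
    (ninv la (u *m refl g))%:R = (ninv la u)%:R - k * phi_sum la (coroot g) + 1 :> rat ->
    exists y, SiB_edge (stab_index la) L b (w, mu) y /\ cl_elt (stab_index la) y = v.
  move=> kint beE rbe be0 bint ugmin N.
  pose y := (u *m refl g *m z, z^T *m (k *: coroot g) + mu).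
  have yS : aff_weyl_S (stab_index la) y.
    apply: aff_min_weyl_S => //; first exact: int_orthM.
      apply: int_vecD => //; apply: int_vec_orth; first exact: int_orthV.
      by apply: int_vecZ => //; apply: int_vec_coroot.
    exact: aff_min_stab.
  exists y; split; last by rewrite cl_eltE //= floor_S_mulr.
  split=> //.
    rewrite !(si_lengthE la_dom) // phi_sumD (phi_sum_stab _ (int_orthV zo)) ?stab_tr //.
    by rewrite phi_sumZ wE !(ninv_mul_stab _ zo zla) N; lra.
  exists be; split=> //; rewrite beE /aff_mul /= int_orth_inv // wE.
  congr (_, _ + mu); first by rewrite mulmxA refl_orth.
  by rewrite coroot_orth // scalemxAr trmx_mul -mulmxA orth_trK.
have wla : pairing (w *m la) (coroot (u *m g)) = pairing la (coroot g).
  by rewrite wE -mulmxA zla coroot_orth // pairing_orth.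
have rug := roots_orth uo rg.
case: gcase => [[br bint]|[qu gs bint]|[qu gl bint]].
- have N : ninv la (u *m refl g) = (ninv la u).+1 by rewrite -lenv -lenu.
  have [ugpos ug0] := bruhat_stab uo rg lg upos N.
  (* No delta part is available here, so positivity of the affine root rests on u g > 0. *)
  apply: (lift (AffFull (u *m g) 0) 0) => //=.
  + by rewrite mul0r.
  + by apply/aff_pos_full => //; right; split=> //; apply/pos_rootsE.
  + by rewrite wla.
  + by move=> r pr lr; left; rewrite scale0r pairing0r; split=> //; apply: ugpos.
  + by rewrite N mul0r subr0 -addn1 natrD.
- have c1 : croot (u *m g) = 1.
    by rewrite croot_orth // /croot memNset //; apply: short_not_long.
  move: qu; rewrite /is_quantum lenv lenu (rho_diff_pairing _ la_dom) => N.
  apply: (lift (AffFull (u *m g) 1) 1) => //=.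
  + by rewrite c1.
  + by apply/aff_pos_full => //; left.
  + by rewrite wla.
  + by rewrite scale1r; apply: quantum_stab.
  + by rewrite mul1r.
- move: qu; rewrite /is_quantum lenv lenu (rho_diff_pairing _ la_dom) => N.
  have ugl : long_roots (u *m g) by apply: long_orth.
  (* For a long root, alpha + 2 delta would translate by two coroots; half of alpha + delta
     translates by one, as k = 1 demands. *)
  apply: (lift (AffHalf (u *m g) 1) 1) => //=.
  + by apply/aff_pos_half.
  + by rewrite wla mulrCA.
  + by rewrite scale1r; apply: quantum_stab.
  + by rewrite mul1r.
Qed.

(** * Paths and the map on path sequences *)

Lemma QBG_path_lift n (L : 'cV[rat]_n * rat) b x u v : dominant L.1 ->
  clos_refl_trans _ (QBG_edge (stab_index L.1) L.1 b) u v ->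
  aff_weyl_S (stab_index L.1) x -> cl_elt (stab_index L.1) x = u ->
  exists y, [/\ clos_refl_trans _ (SiB_edge (stab_index L.1) L b) x y,
    aff_weyl_S (stab_index L.1) y & cl_elt (stab_index L.1) y = v].
Proof.
move=> la_dom uv; elim: uv x => [u' v' e|u'|u' t v' _ IH1 _ IH2] x xS xu.
- have [y [xy yv]] := QBG_edge_lift la_dom xS xu e.
  by exists y; split=> //; [exact: rt_step|case: xy].
- by exists x; split=> //; apply: rt_refl.
have [y [xy yS yt]] := IH1 x xS xu; have [y' [yy' y'S y'v]] := IH2 y yS yt.
by exists y'; split=> //; apply: rt_trans xy yy'.
Qed.

Lemma SiB_path_cl n (L : 'cV[rat]_n * rat) b x y : dominant L.1 ->
  clos_refl_trans _ (SiB_edge (stab_index L.1) L b) x y ->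
  clos_refl_trans _ (QBG_edge (stab_index L.1) L.1 b)
    (cl_elt (stab_index L.1) x) (cl_elt (stab_index L.1) y).
Proof.
move=> la_dom; elim=> [x' y' /(SiB_edge_cl la_dom)|x'|x' t y' _ IH1 _ IH2].
- exact: rt_step.
- exact: rt_refl.
- exact: rt_trans IH1 IH2.
Qed.

(* Lifting proceeds from the last vertex, since the paths of an LS path run from
   each vertex to the previous one. *)
Lemma lift_vertices (T U : eqType) (f : T -> U) (V : T -> Prop) (W : U -> Prop)
    (E : nat -> T -> T -> Prop) (F : nat -> U -> U -> Prop) :
  (forall u, W u -> exists2 x, V x & f x = u) ->
  (forall i x u, F i (f x) u -> V x -> exists y, [/\ E i x y, V y & f y = u]) ->
  forall (u0 : U) us, (forall u, u \in us -> W u) ->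
  (forall i, (0 < i < size us)%N -> F i (nth u0 us i) (nth u0 us i.-1)) ->
  exists xs, [/\ map f xs = us, forall x, x \in xs -> V x &
    forall x0 i, (0 < i < size xs)%N -> E i (nth x0 xs i) (nth x0 xs i.-1)].
Proof.
move=> surj lift u0 us; elim: us E F lift => [|u us IHus] E F lift usW usF.
  by exists [::]; split=> // x0 i; rewrite andbC ltn0.
have [||xs [xsE xsV xsP]] := IHus (E \o succn) (F \o succn) (fun i => lift i.+1).
- by move=> t tus; apply: usW; rewrite inE tus orbT.
- by move=> [//|i] /= i_lt; have := usF i.+2 i_lt.
(* A single remaining vertex gets an arbitrary preimage; otherwise the new head must end a lift that
   starts at the head already chosen for the tail. *)
have [x [xV xu xP]] : exists x, [/\ V x, f x = u &
    forall x0, (0 < size xs)%N -> E 1%N (nth x0 xs 0) x].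
  case: xs xsE xsV {xsP} => [|x1 xs] /= usE xsV.
    by have [|x xV xu] := surj u; [apply: usW; rewrite mem_head|exists x].
  have Fu : F 1%N (f x1) u by have := usF 1%N; rewrite -usE /=; apply.
  have [x [x1x xV xu]] := lift _ _ _ Fu (xsV x1 (mem_head _ _)).
  by exists x.
exists (x :: xs); split=> /=; first by rewrite xu xsE.
  by move=> t; rewrite inE => /orP[/eqP->|/xsV].
move=> x0 [//|[|i]] /=; first by move=> ?; apply: xP.
by move=> i_lt; apply: xsP.
Qed.

Theorem theoremA2p5 (n : nat) (hn : (2 <= n)%N) (L : 'cV[rat]_n * rat)
    (L_wt : level0_weights L) (L_dom : dominant L.1) :
  let la : 'cV[rat]_n := L.1 in
  let S := stab_index la in
  (forall p, SiLS L p -> QLS la (cl S p)) /\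
  (forall q, QLS la q -> exists2 p, SiLS L p & cl S p = q).
Proof.
move=> la S; split=> [[xs ts] [[/= sz hd lst srt] [xsV xsP]]
  |[us ts] [[/= sz hd lst srt] [usV usP]]].
  split; first by rewrite /= size_map.
  split=> /= [u /mapP[x /xsV xV ->]|u0 i].
    rewrite cl_eltE //; apply: floor_S_min => //.
    by case: x xV => w mu /(aff_weyl_S_min L_dom)[].
  rewrite size_map => i_lt; have x0 : 'M[rat]_n * 'cV[rat]_n by exact: (0, 0).
  have i1_lt : (i.-1 < size xs)%N by case/andP: i_lt => _; apply/leq_ltn_trans/leq_pred.
  rewrite !(nth_map x0) //; last by case/andP: i_lt.
  exact/SiB_path_cl/xsP.
have [||xs [usE xsV xsP]] := @lift_vertices _ _ (cl_elt S) (aff_weyl_S S) (min_reps S)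
  (fun i => clos_refl_trans _ (SiB_edge S L ts`_i))
  (fun i => clos_refl_trans _ (QBG_edge S la ts`_i)) _ _ 0 us usV (usP 0).
(* The lift of an isolated vertex u has translation part 0. *)
- move=> u /(min_repsE _ L_dom)[uo upos]; have uS : aff_weyl_S S (u, 0).
    apply: aff_min_weyl_S => // [i|r pr lr]; first by rewrite mxE.
    by left; rewrite pairing0r; split=> //; apply: upos.
  exists (u, 0) => //; rewrite cl_eltE //= -[u in floor_S _ u]mulmx1.
  by rewrite floor_SE //; [exact: int_orth1|rewrite mul1mx].
- move=> i x u xu xS; exact: (QBG_path_lift L_dom xu xS erefl).
exists (xs, ts); last by rewrite /cl /= usE.
split; last by split.
by rewrite /= sz -usE size_map.
Qed.
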